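(* Let $A$ and $H$ be vector spaces with products $A\otimes A\to A$, $H\otimes H\to H$, coproducts $\Delta_A,\Delta_H$, and linear maps $\rightharpoonup,\leftharpoonup,\triangleright,\triangleleft,\sigma,\theta,\phi,\psi,\rho,\gamma,P,Q$ (as in the context) such that $(A,H,\sigma,\theta)$ is a cocycle cross product system, $(A,H,P,Q)$ is a cycle cross coproduct system and $(A,H,\sigma,\theta,P,Q)$ is a cocycle double matched pair. Then the vector space $A\oplus H$ with product $$(a,x)(b,y)=\big(ab+x\rightharpoonup b+a\leftharpoonup y+\sigma(x,y),\;xy+x\triangleleft b+a\triangleright y+\theta(a,b)\big)$$ and coproduct $\Delta(a)=(\Delta_A+\phi+\psi+P)(a)$, $\Delta(x)=(\Delta_H+\rho+\gamma+Q)(x)$ for $a,b\in A$, $x,y\in H$, is a left-symmetric bialgebra if and only if both $A$ and $H$ are cocycle braided left-symmetric bialgebras.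
   Context: All vector spaces are over a fixed field of characteristic zero. $\tau(u\otimes v)=v\otimes u$, $\tau_{12}(u\otimes v\otimes w)=v\otimes u\otimes w$, $[a,b]:=ab-ba$. A left-symmetric algebra has a bilinear product with $(ab)c-a(bc)=(ba)c-b(ac)$. A left-symmetric coalgebra has a linear coproduct $\Delta$ with $(\Delta\otimes\mathrm{id})\Delta(c)-(\mathrm{id}\otimes\Delta)\Delta(c)$ fixed by $\tau_{12}$. A left-symmetric bialgebra is both, with $\Delta([a,b])=ab_1\otimes b_2+b_1\otimes[a,b_2]-ba_1\otimes a_2-a_1\otimes[b,a_2]$ and $(\mathrm{id}-\tau)\Delta(ab)=(\mathrm{id}-\tau)(a_1\otimes a_2b+ab_1\otimes b_2+b_1\otimes ab_2)$. Maps and (summation-suppressed) notation: $\rightharpoonup:H\otimes A\to A$, $\leftharpoonup:A\otimes H\to A$, $\triangleright:A\otimes H\to H$, $\triangleleft:H\otimes A\to H$, $\sigma:H\otimes H\to A$, $\theta:A\otimes A\to H$; $\Delta_A(a)=a_1\otimes a_2$, $\Delta_H(x)=x_1\otimes x_2$, $\phi:A\to H\otimes A$, $\phi(a)=a_{(-1)}\otimes a_{(0)}$; $\psi:A\to A\otimes H$, $\psi(a)=a_{(0)}\otimes a_{(1)}$; $\rho:H\to A\otimes H$, $\rho(x)=x_{[-1]}\otimes x_{[0]}$; $\gamma:H\to H\otimes A$, $\gamma(x)=x_{[0]}\otimes x_{[1]}$; $P:A\to H\otimes H$, $P(a)=a_{\langle1\rangle}\otimes a_{\langle2\rangle}$;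 $Q:H\to A\otimes A$, $Q(x)=x_{\{1\}}\otimes x_{\{2\}}$. All identities are for all $a,b,c\in A$, $x,y,z\in H$. COCYCLE CROSS PRODUCT SYSTEM $(A,H,\sigma,\theta)$: the following hold. - ($\sigma$ cocycle) $\sigma(xy,z)-\sigma(x,yz)+\sigma(x,y)\leftharpoonup z-x\rightharpoonup\sigma(y,z)$ is symmetric in $x,y$. - ($\theta$ cocycle) $\theta(ab,c)-\theta(a,bc)+\theta(a,b)\triangleleft c-a\triangleright\theta(b,c)$ is symmetric in $a,b$. - ($H$ is a $\sigma$-left-symmetric algebra) $(xy)z-x(yz)+\sigma(x,y)\triangleright z-x\triangleleft\sigma(y,z)$ is symmetric in $x,y$. - ($A$ is a $\theta$-left-symmetric algebra) $(ab)c-a(bc)+\theta(a,b)\rightharpoonup c-a\leftharpoonup\theta(b,c)$ is symmetric in $a,b$. - $[a,b]\triangleright x+(\theta(a,b)-\theta(b,a))x=a\triangleright(b\triangleright x)-b\triangleright(a\triangleright x)+\theta(a,b\leftharpoonup x)-\theta(b,a\leftharpoonup x)$. - $x\triangleleft(ab)+x\theta(a,b)=a\triangleright(x\triangleleft b)+(x\triangleleft a-a\triangleright x)\triangleleft b+\theta(x\rightharpoonup a-a\leftharpoonup x,b)+\theta(a,x\rightharpoonup b)$. - $a\triangleright(xy)+\theta(a,\sigma(x,y))=(a\triangleright x-x\triangleleft a)y+(a\leftharpoonup x-x\rightharpoonup a)\triangleright y+x\triangleleft(a\leftharpoonup y)+x(a\triangleright y)$. - $[x,y]\triangleleft a+\theta(\sigma(x,y)-\sigma(y,x),a)=x\triangleleft(y\rightharpoonup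 a)-y\triangleleft(x\rightharpoonup a)+x(y\triangleleft a)-y(x\triangleleft a)$. - $[x,y]\rightharpoonup a+(\sigma(x,y)-\sigma(y,x))a=x\rightharpoonup(y\rightharpoonup a)-y\rightharpoonup(x\rightharpoonup a)+\sigma(x,y\triangleleft a)-\sigma(y,x\triangleleft a)$. - $a\leftharpoonup(xy)+a\sigma(x,y)=x\rightharpoonup(a\leftharpoonup y)+(a\leftharpoonup x-x\rightharpoonup a)\leftharpoonup y+\sigma(a\triangleright x-x\triangleleft a,y)+\sigma(x,a\triangleright y)$. - $x\rightharpoonup(ab)+\sigma(x,\theta(a,b))=(x\rightharpoonup a-a\leftharpoonup x)b+(x\triangleleft a-a\triangleright x)\rightharpoonup b+a(x\rightharpoonup b)+a\leftharpoonup(x\triangleleft b)$. - $[a,b]\leftharpoonup x+\sigma(\theta(a,b)-\theta(b,a),x)=a(b\leftharpoonup x)+a\leftharpoonup(b\triangleright x)-b(a\leftharpoonup x)-b\leftharpoonup(a\triangleright x)$. CYCLE CROSS COPRODUCT SYSTEM $(A,H,P,Q)$: the following eight elements are fixed by $\tau_{12}$: - ($P$ cycle) $\Delta_H(a_{\langle1\rangle})\otimes a_{\langle2\rangle}-a_{\langle1\rangle}\otimes\Delta_H(a_{\langle2\rangle})+P(a_{(0)})\otimes a_{(1)}-a_{(-1)}\otimes P(a_{(0)})$; - ($Q$ cycle) $\Delta_A(x_{\{1\}})\otimes x_{\{2\}}-x_{\{1\}}\otimes\Delta_A(x_{\{2\}})+Q(x_{[0]})\otimes x_{[1]}-x_{[-1]}\otimes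 Q(x_{[0]})$; - ($H$ is a $P$-left-symmetric coalgebra) $\Delta_H(x_1)\otimes x_2-x_1\otimes\Delta_H(x_2)+P(x_{[-1]})\otimes x_{[0]}-x_{[0]}\otimes P(x_{[1]})$; - ($A$ is a $Q$-left-symmetric coalgebra) $\Delta_A(a_1)\otimes a_2-a_1\otimes\Delta_A(a_2)+Q(a_{(-1)})\otimes a_{(0)}-a_{(0)}\otimes Q(a_{(1)})$; - $\Delta_A(a_{(0)})\otimes a_{(1)}+Q(a_{\langle1\rangle})\otimes a_{\langle2\rangle}-a_1\otimes\psi(a_2)-a_{(0)}\otimes\rho(a_{(1)})$; - $\Delta_H(x_{[0]})\otimes x_{[1]}+P(x_{\{1\}})\otimes x_{\{2\}}-x_{[0]}\otimes\phi(x_{[1]})-x_1\otimes\gamma(x_2)$; - $\Delta_H(a_{(-1)})\otimes a_{(0)}+P(a_1)\otimes a_2-a_{(-1)}\otimes\phi(a_{(0)})-a_{\langle1\rangle}\otimes\gamma(a_{\langle2\rangle})$; - $x_{[-1]}\otimes\rho(x_{[0]})+x_{\{1\}}\otimes\psi(x_{\{2\}})-\Delta_A(x_{[-1]})\otimes x_{[0]}-Q(x_1)\otimes x_2$; and - $\phi(a_1)\otimes a_2+\gamma(a_{(-1)})\otimes a_{(0)}-a_{(-1)}\otimes\Delta_A(a_{(0)})-a_{\langle1\rangle}\otimes Q(a_{\langle2\rangle})=\tau_{12}\big(\psi(a_1)\otimes a_2+\rho(a_{(-1)})\otimes a_{(0)}-a_1\otimes\phi(a_2)-a_{(0)}\otimes\gamma(a_{(1)})\big)$;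 - $\rho(x_1)\otimes x_2+\psi(x_{[-1]})\otimes x_{[0]}-x_{[-1]}\otimes\Delta_H(x_{[0]})-x_{\{1\}}\otimes P(x_{\{2\}})=\tau_{12}\big(\gamma(x_1)\otimes x_2+\phi(x_{[-1]})\otimes x_{[0]}-x_{[0]}\otimes\psi(x_{[1]})-x_1\otimes\rho(x_2)\big)$; - $a_{(0)}\otimes\Delta_H(a_{(1)})+a_1\otimes P(a_2)-\psi(a_{(0)})\otimes a_{(1)}-\rho(a_{\langle1\rangle})\otimes a_{\langle2\rangle}=\tau_{12}\big(a_{(-1)}\otimes\psi(a_{(0)})+a_{\langle1\rangle}\otimes\rho(a_{\langle2\rangle})-\phi(a_{(0)})\otimes a_{(1)}-\gamma(a_{\langle1\rangle})\otimes a_{\langle2\rangle}\big)$; - $x_{[0]}\otimes\Delta_A(x_{[1]})+x_1\otimes Q(x_2)-\gamma(x_{[0]})\otimes x_{[1]}-\phi(x_{\{1\}})\otimes x_{\{2\}}=\tau_{12}\big(x_{[-1]}\otimes\gamma(x_{[0]})+x_{\{1\}}\otimes\phi(x_{\{2\}})-\rho(x_{[0]})\otimes x_{[1]}-\psi(x_{\{1\}})\otimes x_{\{2\}}\big)$. COCYCLE DOUBLE MATCHED PAIR $(A,H,\sigma,\theta,P,Q)$: the following twenty identities hold. 1. $\phi([a,b])+\gamma(\theta(a,b)-\theta(b,a))=a_{(-1)}\otimes[a_{(0)},b]+(a\triangleright b_{(-1)})\otimes b_{(0)}+a_{\langle1\rangle}\otimes(a_{\langle2\rangle}\rightharpoonup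 b)+\theta(a,b_1)\otimes b_2+b_{(-1)}\otimes[a,b_{(0)}]+b_{\langle1\rangle}\otimes(a\leftharpoonup b_{\langle2\rangle})-(b\triangleright a_{(-1)})\otimes a_{(0)}-b_{\langle1\rangle}\otimes(b_{\langle2\rangle}\rightharpoonup a)-\theta(b,a_1)\otimes a_2-a_{\langle1\rangle}\otimes(b\leftharpoonup a_{\langle2\rangle})$. 2. $\psi([a,b])+\rho(\theta(a,b)-\theta(b,a))=ab_{(0)}\otimes b_{(1)}+a_{(0)}\otimes(a_{(1)}\triangleleft b)+(a\leftharpoonup b_{\langle1\rangle})\otimes b_{\langle2\rangle}+a_1\otimes\theta(a_2,b)+b_{(0)}\otimes(a\triangleright b_{(1)})+b_1\otimes\theta(a,b_2)-ba_{(0)}\otimes a_{(1)}-b_{(0)}\otimes(b_{(1)}\triangleleft a)-(b\leftharpoonup a_{\langle1\rangle})\otimes a_{\langle2\rangle}-b_1\otimes\theta(b_2,a)-a_{(0)}\otimes(b\triangleright a_{(1)})-a_1\otimes\theta(b,a_2)$. 3. $\rho([x,y])+\psi(\sigma(x,y)-\sigma(y,x))=x_{[-1]}\otimes[x_{[0]},y]+(x\rightharpoonup y_{[-1]})\otimes y_{[0]}+x_{\{1\}}\otimes(x_{\{2\}}\triangleright y)+\sigma(x,y_1)\otimes y_2+y_{[-1]}\otimes[x,y_{[0]}]+y_{\{1\}}\otimes(x\triangleleft y_{\{2\}})-(y\rightharpoonup x_{[-1]})\otimes x_{[0]}-y_{\{1\}}\otimes(y_{\{2\}}\triangleright x)-\sigma(y,x_1)\otimes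 x_2-x_{\{1\}}\otimes(y\triangleleft x_{\{2\}})$. 4. $\gamma([x,y])+\phi(\sigma(x,y)-\sigma(y,x))=x_{[0]}\otimes(x_{[1]}\leftharpoonup y)+xy_{[0]}\otimes y_{[1]}+x_1\otimes\sigma(x_2,y)+(x\triangleleft y_{\{1\}})\otimes y_{\{2\}}+y_1\otimes\sigma(x,y_2)+y_{[0]}\otimes(x\rightharpoonup y_{[1]})-y_{[0]}\otimes(y_{[1]}\leftharpoonup x)-yx_{[0]}\otimes x_{[1]}-y_1\otimes\sigma(y_2,x)-(y\triangleleft x_{\{1\}})\otimes x_{\{2\}}-x_1\otimes\sigma(y,x_2)-x_{[0]}\otimes(y\rightharpoonup x_{[1]})$. 5. $\Delta_A(x\rightharpoonup b)-\Delta_A(b\leftharpoonup x)+Q(x\triangleleft b)-Q(b\triangleright x)=x_{[-1]}\otimes(x_{[0]}\rightharpoonup b)+(x\rightharpoonup b_1)\otimes b_2+x_{\{1\}}\otimes[x_{\{2\}},b]+\sigma(x,b_{(-1)})\otimes b_{(0)}+b_1\otimes(x\rightharpoonup b_2)+b_{(0)}\otimes\sigma(x,b_{(1)})-b_1\otimes(b_2\leftharpoonup x)-(b\leftharpoonup x_{[0]})\otimes x_{[1]}-b_{(0)}\otimes\sigma(b_{(1)},x)-bx_{\{1\}}\otimes x_{\{2\}}-x_{[-1]}\otimes(b\leftharpoonup x_{[0]})$. 6. $\Delta_H(a\triangleright y)-\Delta_H(y\triangleleft a)+P(a\leftharpoonup y)-P(y\rightharpoonup a)=a_{(-1)}\otimes(a_{(0)}\triangleright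 y)+(a\triangleright y_1)\otimes y_2+a_{\langle1\rangle}\otimes[a_{\langle2\rangle},y]+\theta(a,y_{[-1]})\otimes y_{[0]}+y_1\otimes(a\triangleright y_2)+y_{[0]}\otimes\theta(a,y_{[1]})-y_1\otimes(y_2\triangleleft a)-(y\triangleleft a_{(0)})\otimes a_{(1)}-y_{[0]}\otimes\theta(y_{[1]},a)-ya_{\langle1\rangle}\otimes a_{\langle2\rangle}-a_{(-1)}\otimes(y\triangleleft a_{(0)})$. 7. $\Delta_H(\theta(a,b)-\theta(b,a))+P([a,b])=a_{(-1)}\otimes\theta(a_{(0)},b)+a_{\langle1\rangle}\otimes(a_{\langle2\rangle}\triangleleft b)+\theta(a,b_{(0)})\otimes b_{(1)}+(a\triangleright b_{\langle1\rangle})\otimes b_{\langle2\rangle}+b_{(-1)}\otimes\theta(a,b_{(0)})+b_{\langle1\rangle}\otimes(a\triangleright b_{\langle2\rangle})-b_{(-1)}\otimes\theta(b_{(0)},a)-b_{\langle1\rangle}\otimes(b_{\langle2\rangle}\triangleleft a)-\theta(b,a_{(0)})\otimes a_{(1)}-(b\triangleright a_{\langle1\rangle})\otimes a_{\langle2\rangle}-a_{(-1)}\otimes\theta(b,a_{(0)})-a_{\langle1\rangle}\otimes(b\triangleright a_{\langle2\rangle})$. 8. $\Delta_A(\sigma(x,y)-\sigma(y,x))+Q([x,y])=x_{[-1]}\otimes\sigma(x_{[0]},y)+x_{\{1\}}\otimes(x_{\{2\}}\leftharpoonup y)+\sigma(x,y_{[0]})\otimes y_{[1]}+(x\rightharpoonup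 y_{\{1\}})\otimes y_{\{2\}}+y_{[-1]}\otimes\sigma(x,y_{[0]})+y_{\{1\}}\otimes(x\rightharpoonup y_{\{2\}})-y_{[-1]}\otimes\sigma(y_{[0]},x)-y_{\{1\}}\otimes(y_{\{2\}}\leftharpoonup x)-\sigma(y,x_{[0]})\otimes x_{[1]}-(y\rightharpoonup x_{\{1\}})\otimes x_{\{2\}}-x_{[-1]}\otimes\sigma(y,x_{[0]})-x_{\{1\}}\otimes(y\rightharpoonup x_{\{2\}})$. 9. $\phi(x\rightharpoonup b)-\phi(b\leftharpoonup x)+\gamma(x\triangleleft b)-\gamma(b\triangleright x)=x_1\otimes(x_2\rightharpoonup b)+xb_{(-1)}\otimes b_{(0)}+x_{[0]}\otimes[x_{[1]},b]+(x\triangleleft b_1)\otimes b_2+b_{(-1)}\otimes(x\rightharpoonup b_{(0)})+b_{\langle1\rangle}\otimes\sigma(x,b_{\langle2\rangle})-b_{(-1)}\otimes(b_{(0)}\leftharpoonup x)-\theta(b,x_{\{1\}})\otimes x_{\{2\}}-(b\triangleright x_{[0]})\otimes x_{[1]}-b_{\langle1\rangle}\otimes\sigma(b_{\langle2\rangle},x)-x_1\otimes(b\leftharpoonup x_2)$. 10. $\psi(x\rightharpoonup b)-\psi(b\leftharpoonup x)+\rho(x\triangleleft b)-\rho(b\triangleright x)=(x\rightharpoonup b_{(0)})\otimes b_{(1)}+x_{\{1\}}\otimes\theta(x_{\{2\}},b)+x_{[-1]}\otimes(x_{[0]}\triangleleft b)+\sigma(x,b_{\langle1\rangle})\otimes b_{\langle2\rangle}+b_1\otimes(x\triangleleft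 b_2)+b_{(0)}\otimes[x,b_{(1)}]-(b\leftharpoonup x_1)\otimes x_2-b_1\otimes(b_2\triangleright x)-bx_{[-1]}\otimes x_{[0]}-x_{[-1]}\otimes(b\triangleright x_{[0]})-x_{\{1\}}\otimes\theta(b,x_{\{2\}})$. 11. $\phi(ab)+\gamma(\theta(a,b))-\tau\psi(ab)-\tau\rho(\theta(a,b))=a_{(-1)}\otimes a_{(0)}b+(a\triangleright b_{(-1)})\otimes b_{(0)}+a_{\langle1\rangle}\otimes(a_{\langle2\rangle}\rightharpoonup b)+\theta(a,b_1)\otimes b_2+b_{(-1)}\otimes ab_{(0)}+b_{\langle1\rangle}\otimes(a\leftharpoonup b_{\langle2\rangle})-\tau\big(ab_{(0)}\otimes b_{(1)}+a_{(0)}\otimes(a_{(1)}\triangleleft b)+(a\leftharpoonup b_{\langle1\rangle})\otimes b_{\langle2\rangle}+a_1\otimes\theta(a_2,b)+b_{(0)}\otimes(a\triangleright b_{(1)})+b_1\otimes\theta(a,b_2)\big)$. 12. $\rho(xy)+\psi(\sigma(x,y))-\tau\gamma(xy)-\tau\phi(\sigma(x,y))=x_{[-1]}\otimes x_{[0]}y+(x\rightharpoonup y_{[-1]})\otimes y_{[0]}+x_{\{1\}}\otimes(x_{\{2\}}\triangleright y)+\sigma(x,y_1)\otimes y_2+y_{[-1]}\otimes xy_{[0]}+y_{\{1\}}\otimes(x\triangleleft y_{\{2\}})-\tau\big(x_{[0]}\otimes(x_{[1]}\leftharpoonup y)+xy_{[0]}\otimes y_{[1]}+x_1\otimes\sigma(x_2,y)+(x\triangleleft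 y_{\{1\}})\otimes y_{\{2\}}+y_1\otimes\sigma(x,y_2)+y_{[0]}\otimes(x\rightharpoonup y_{[1]})\big)$. 13. $(\mathrm{id}-\tau)(\Delta_A(x\rightharpoonup b)+Q(x\triangleleft b))=(\mathrm{id}-\tau)\big(x_{[-1]}\otimes(x_{[0]}\rightharpoonup b)+(x\rightharpoonup b_1)\otimes b_2+x_{\{1\}}\otimes x_{\{2\}}b+\sigma(x,b_{(-1)})\otimes b_{(0)}+b_1\otimes(x\rightharpoonup b_2)+b_{(0)}\otimes\sigma(x,b_{(1)})\big)$. 14. $(\mathrm{id}-\tau)(\Delta_A(a\leftharpoonup y)+Q(a\triangleright y))=(\mathrm{id}-\tau)\big(a_1\otimes(a_2\leftharpoonup y)+(a\leftharpoonup y_{[0]})\otimes y_{[1]}+a_{(0)}\otimes\sigma(a_{(1)},y)+ay_{\{1\}}\otimes y_{\{2\}}+y_{[-1]}\otimes(a\leftharpoonup y_{[0]})+y_{\{1\}}\otimes ay_{\{2\}}\big)$. 15. $(\mathrm{id}-\tau)(\Delta_H(a\triangleright y)+P(a\leftharpoonup y))=(\mathrm{id}-\tau)\big(a_{(-1)}\otimes(a_{(0)}\triangleright y)+(a\triangleright y_1)\otimes y_2+a_{\langle1\rangle}\otimes a_{\langle2\rangle}y+\theta(a,y_{[-1]})\otimes y_{[0]}+y_1\otimes(a\triangleright y_2)+y_{[0]}\otimes\theta(a,y_{[1]})\big)$. 16. $(\mathrm{id}-\tau)(\Delta_H(x\triangleleft b)+P(x\rightharpoonup b))=(\mathrm{id}-\tau)\big(x_1\otimes(x_2\triangleleft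 b)+(x\triangleleft b_{(0)})\otimes b_{(1)}+x_{[0]}\otimes\theta(x_{[1]},b)+xb_{\langle1\rangle}\otimes b_{\langle2\rangle}+b_{\langle1\rangle}\otimes xb_{\langle2\rangle}+b_{(-1)}\otimes(x\triangleleft b_{(0)})\big)$. 17. $(\mathrm{id}-\tau)(\Delta_H(\theta(a,b))+P(ab))=(\mathrm{id}-\tau)\big(a_{(-1)}\otimes\theta(a_{(0)},b)+a_{\langle1\rangle}\otimes(a_{\langle2\rangle}\triangleleft b)+\theta(a,b_{(0)})\otimes b_{(1)}+(a\triangleright b_{\langle1\rangle})\otimes b_{\langle2\rangle}+b_{(-1)}\otimes\theta(a,b_{(0)})+b_{\langle1\rangle}\otimes(a\triangleright b_{\langle2\rangle})\big)$. 18. $(\mathrm{id}-\tau)(\Delta_A(\sigma(x,y))+Q(xy))=(\mathrm{id}-\tau)\big(x_{[-1]}\otimes\sigma(x_{[0]},y)+x_{\{1\}}\otimes(x_{\{2\}}\leftharpoonup y)+\sigma(x,y_{[0]})\otimes y_{[1]}+(x\rightharpoonup y_{\{1\}})\otimes y_{\{2\}}+y_{[-1]}\otimes\sigma(x,y_{[0]})+y_{\{1\}}\otimes(x\rightharpoonup y_{\{2\}})\big)$. 19. $\phi(x\rightharpoonup b)+\gamma(x\triangleleft b)-\tau\psi(x\rightharpoonup b)-\tau\rho(x\triangleleft b)=x_1\otimes(x_2\rightharpoonup b)+xb_{(-1)}\otimes b_{(0)}+x_{[0]}\otimes x_{[1]}b+(x\triangleleft b_1)\otimes b_2+b_{(-1)}\otimes(x\rightharpoonup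 b_{(0)})+b_{\langle1\rangle}\otimes\sigma(x,b_{\langle2\rangle})-\tau\big((x\rightharpoonup b_{(0)})\otimes b_{(1)}+x_{\{1\}}\otimes\theta(x_{\{2\}},b)+x_{[-1]}\otimes(x_{[0]}\triangleleft b)+\sigma(x,b_{\langle1\rangle})\otimes b_{\langle2\rangle}+b_1\otimes(x\triangleleft b_2)+b_{(0)}\otimes xb_{(1)}\big)$. 20. $\psi(a\leftharpoonup y)+\rho(a\triangleright y)-\tau\phi(a\leftharpoonup y)-\tau\gamma(a\triangleright y)=a_{(0)}\otimes a_{(1)}y+(a\leftharpoonup y_1)\otimes y_2+a_1\otimes(a_2\triangleright y)+ay_{[-1]}\otimes y_{[0]}+y_{[-1]}\otimes(a\triangleright y_{[0]})+y_{\{1\}}\otimes\theta(a,y_{\{2\}})-\tau\big(a_{(-1)}\otimes(a_{(0)}\leftharpoonup y)+\theta(a,y_{\{1\}})\otimes y_{\{2\}}+(a\triangleright y_{[0]})\otimes y_{[1]}+a_{\langle1\rangle}\otimes\sigma(a_{\langle2\rangle},y)+y_1\otimes(a\leftharpoonup y_2)+y_{[0]}\otimes ay_{[1]}\big)$. COCYCLE BRAIDED LEFT-SYMMETRIC BIALGEBRAS. $A$ is one if it is a $\theta$-left-symmetric algebra and a $Q$-left-symmetric coalgebra and - $\Delta_A([a,b])+Q\theta(a,b)-Q\theta(b,a)=ab_1\otimes b_2+b_1\otimes[a,b_2]-ba_1\otimes a_2-a_1\otimes[b,a_2]+a_{(0)}\otimes(a_{(1)}\rightharpoonup b)+(a\leftharpoonup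 b_{(-1)})\otimes b_{(0)}+b_{(0)}\otimes(a\leftharpoonup b_{(1)})-b_{(0)}\otimes(b_{(1)}\rightharpoonup a)-(b\leftharpoonup a_{(-1)})\otimes a_{(0)}-a_{(0)}\otimes(b\leftharpoonup a_{(1)})$; - $(\mathrm{id}-\tau)(\Delta_A(ab)+Q\theta(a,b))=(\mathrm{id}-\tau)\big(a_1\otimes a_2b+ab_1\otimes b_2+b_1\otimes ab_2+a_{(0)}\otimes(a_{(1)}\rightharpoonup b)+(a\leftharpoonup b_{(-1)})\otimes b_{(0)}+b_{(0)}\otimes(a\leftharpoonup b_{(1)})\big)$. $H$ is one if it is a $\sigma$-left-symmetric algebra and a $P$-left-symmetric coalgebra and - $\Delta_H([x,y])+P\sigma(x,y)-P\sigma(y,x)=x_1\otimes[x_2,y]+xy_1\otimes y_2-y_1\otimes[y_2,x]-yx_1\otimes x_2+x_{[0]}\otimes(x_{[1]}\triangleright y)+(x\triangleleft y_{[-1]})\otimes y_{[0]}+y_{[0]}\otimes(x\triangleleft y_{[1]})-y_{[0]}\otimes(y_{[1]}\triangleright x)-(y\triangleleft x_{[-1]})\otimes x_{[0]}-x_{[0]}\otimes(y\triangleleft x_{[1]})$; - $(\mathrm{id}-\tau)(\Delta_H(xy)+P\sigma(x,y))=(\mathrm{id}-\tau)\big(x_1\otimes x_2y+xy_1\otimes y_2+y_1\otimes xy_2+x_{[0]}\otimes(x_{[1]}\triangleright y)+(x\triangleleft y_{[-1]})\otimes y_{[0]}+y_{[0]}\otimes(x\triangleleft y_{[1]})\big)$.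 *)

(* Defs.v *)
From HB Require Import structures.
From mathcomp Require Import all_boot all_order all_algebra.
From mathcomp Require Import boolp.

Set Implicit Arguments.
Unset Strict Implicit.
Unset Printing Implicit Defensive.

Import GRing.Theory.
Local Open Scope ring_scope.
Local Open Scope quotient_scope.

(* Tensor product of two (possibly infinite-dimensional) vector spaces: formal
   sums of pairs, represented by sequences, modulo the congruence generated by
   the usual relations. [tsum_tens], [tsum_linear] and [tsum_unique] are its
   universal property. *)
Section Tensor.
Variables (K : fieldType) (U V : lmodType K).

Inductive tens_eq : seq (U * V) -> seq (U * V) -> Prop :=
| tens_refl s : tens_eq s s
| tens_sym s t : tens_eq s t -> tens_eq t s
| tens_trans s t r : tens_eq s t -> tens_eq t r -> tens_eq s r
| tens_cat s s' t t' : tens_eq s s' -> tens_eq t t' -> tens_eq (s ++ t) (s' ++ t')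
| tens_catC s t : tens_eq (s ++ t) (t ++ s)
| tens_addl u u' v : tens_eq [:: (u + u', v)] [:: (u, v); (u', v)]
| tens_addr u v v' : tens_eq [:: (u, v + v')] [:: (u, v); (u, v')]
| tens_scale k u v : tens_eq [:: (k *: u, v)] [:: (u, k *: v)]
| tens_zero v : tens_eq [:: (0, v)] [::].

Definition tens_eqb (s t : seq (U * V)) : bool := `[< tens_eq s t >].

Lemma tens_eqb_refl : reflexive tens_eqb.
Proof. by move=> s; apply/asboolP; apply: tens_refl. Qed.
Lemma tens_eqb_sym : symmetric tens_eqb.
Proof. by move=> s t; apply/asboolP/asboolP; apply: tens_sym. Qed.
Lemma tens_eqb_trans : transitive tens_eqb.
Proof. by move=> s t r /asboolP ts /asboolP sr; apply/asboolP; apply: tens_trans ts sr. Qed.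

Canonical tens_equiv := EquivRel tens_eqb tens_eqb_refl tens_eqb_sym tens_eqb_trans.

Definition tensor : Type := {eq_quot tens_equiv}.

HB.instance Definition _ := Choice.on tensor.
HB.instance Definition _ := EqQuotient.on tensor.

Lemma tens_piP s t : \pi_tensor s = \pi_tensor t <-> tens_eq s t.
Proof.
split=> [/eqquotP /asboolP //|st]; apply/eqquotP; exact/asboolP.
Qed.

Lemma tens_repr s : tens_eq (repr (\pi_tensor s)) s.
Proof. by apply/tens_piP; rewrite reprK. Qed.

Lemma tens_ind (P : tensor -> Prop) :
  (forall s, P (\pi_tensor s)) -> forall t, P t.
Proof. by move=> Ps t; rewrite -[t]reprK. Qed.

Definition tens_scale_seq (k : K) (s : seq (U * V)) := [seq (k *: p.1, p.2) | p <- s].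

Lemma tens_scale_seq_eq k s t :
  tens_eq s t -> tens_eq (tens_scale_seq k s) (tens_scale_seq k t).
Proof.
rewrite /tens_scale_seq; elim=> {s t} /=.
- by move=> s; apply: tens_refl.
- by move=> s t _; apply: tens_sym.
- by move=> s t r _ st _; apply: tens_trans.
- by move=> s s' t t' _ H _ H'; rewrite !map_cat; apply: tens_cat.
- by move=> s t; rewrite !map_cat; apply: tens_catC.
- by move=> u u' v; rewrite scalerDr; apply: tens_addl.
- by move=> u v v'; apply: tens_addr.
- by move=> l u v; rewrite scalerA mulrC -scalerA; apply: tens_scale.
- by move=> v; rewrite scaler0; apply: tens_zero.
Qed.

Definition tens_add (t t' : tensor) : tensor := \pi_tensor (repr t ++ repr t').
Definition tens_zmul (k : K) (t : tensor) : tensor :=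
  \pi_tensor (tens_scale_seq k (repr t)).

Lemma tens_addE s t :
  tens_add (\pi_tensor s) (\pi_tensor t) = \pi_tensor (s ++ t).
Proof. by apply/tens_piP; apply: tens_cat; apply: tens_repr. Qed.

Lemma tens_zmulE k s :
  tens_zmul k (\pi_tensor s) = \pi_tensor (tens_scale_seq k s).
Proof. by apply/tens_piP; apply: tens_scale_seq_eq; apply: tens_repr. Qed.

Lemma tens_addA : associative tens_add.
Proof.
by move=> x y z; elim/tens_ind: x => s; elim/tens_ind: y => t; elim/tens_ind: z => r;
rewrite !tens_addE catA.
Qed.

Lemma tens_addC : commutative tens_add.
Proof.
move=> x y; elim/tens_ind: x => s; elim/tens_ind: y => t; rewrite !tens_addE.
by apply/tens_piP; apply: tens_catC.
Qed.

Lemma tens_add0 : left_id (\pi_tensor [::]) tens_add.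
Proof. by elim/tens_ind=> s; rewrite tens_addE. Qed.

Lemma tens_zmulDl (s : seq (U * V)) (k l : K) :
  \pi_tensor (tens_scale_seq (k + l) s) =
  tens_add (tens_zmul k (\pi_tensor s)) (tens_zmul l (\pi_tensor s)).
Proof.
rewrite !tens_zmulE tens_addE; apply/tens_piP.
elim: s => [|[u v] s IHs] /=; first exact: tens_refl.
rewrite scalerDl -cat1s.
apply: (@tens_trans _ ([:: (k *: u, v); (l *: u, v)] ++
  (tens_scale_seq k s ++ tens_scale_seq l s))).
  by apply: tens_cat IHs; apply: tens_addl.
rewrite -[_ :: (_ ++ _)]/([:: (k *: u, v)] ++ (tens_scale_seq k s
  ++ [:: (l *: u, v)] ++ tens_scale_seq l s)).
rewrite -[[:: _; _]]/([:: (k *: u, v)] ++ [:: (l *: u, v)]) -catA.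
apply: tens_cat; first exact: tens_refl.
rewrite !catA; apply: tens_cat; last exact: tens_refl.
exact: tens_catC.
Qed.

Lemma tens_zmul0 s : tens_zmul 0 (\pi_tensor s) = \pi_tensor [::].
Proof.
rewrite tens_zmulE; apply/tens_piP; elim: s => [|[u v] s IHs] /=.
  exact: tens_refl.
rewrite scale0r -[X in tens_eq _ X]/([::] ++ [::]) -cat1s.
by apply: tens_cat IHs; apply: tens_zero.
Qed.

Lemma tens_zmul1 : left_id 1 tens_zmul.
Proof.
elim/tens_ind=> s; rewrite tens_zmulE /tens_scale_seq; congr (\pi _).
by rewrite -[RHS]map_id; apply: eq_map => -[u v] /=; rewrite scale1r.
Qed.

Lemma tens_addN : left_inverse (\pi_tensor [::]) (tens_zmul (-1)) tens_add.
Proof.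
elim/tens_ind=> s; rewrite -[X in tens_add _ X]tens_zmul1 -tens_zmulDl addNr.
by rewrite -tens_zmulE tens_zmul0.
Qed.

HB.instance Definition _ := GRing.isZmodule.Build tensor
  tens_addA tens_addC tens_add0 tens_addN.

Lemma tens_zmulA k l t : tens_zmul k (tens_zmul l t) = tens_zmul (k * l) t.
Proof.
elim/tens_ind: t => s; rewrite !tens_zmulE /tens_scale_seq -map_comp.
by congr (\pi _); apply: eq_map => -[u v] /=; rewrite scalerA.
Qed.

Lemma tens_zmulDr : right_distributive tens_zmul +%R.
Proof.
move=> k x y; elim/tens_ind: x => s; elim/tens_ind: y => t.
rewrite -![_ + _]/(tens_add _ _) tens_addE !tens_zmulE tens_addE.
by rewrite /tens_scale_seq map_cat.
Qed.

Lemma tens_zmulD t : {morph tens_zmul^~ t : k l / k + l}.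
Proof. by move=> k l /=; elim/tens_ind: t => s; rewrite {1}tens_zmulE tens_zmulDl. Qed.

HB.instance Definition _ := GRing.Zmodule_isLmodule.Build K tensor
  tens_zmulA tens_zmul1 tens_zmulDr tens_zmulD.

Definition tens (u : U) (v : V) : tensor := \pi_tensor [:: (u, v)].

Lemma tens_is_bilinear : bilinear_for *:%R *:%R tens.
Proof.
have scaleE k s : k *: (\pi_tensor s) = \pi_tensor (tens_scale_seq k s).
  exact: tens_zmulE.
have addE s t : \pi_tensor s + \pi_tensor t = \pi_tensor (s ++ t).
  exact: tens_addE.
have scalerE k u v : tens_eq [:: (u, k *: v)] [:: (k *: u, v)].
  by apply: tens_sym; apply: tens_scale.
split=> [v k u u' | u k v v'] /=; rewrite /tens scaleE addE; apply/tens_piP.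
  exact: tens_addl.
apply: tens_trans (tens_addr _ _ _) _.
exact: tens_cat (scalerE _ _ _) (tens_refl [:: (u, v')]).
Qed.

HB.instance Definition _ := bilinear_isBilinear.Build K U V tensor *:%R *:%R
  tens tens_is_bilinear.

Lemma tensor_sum (t : tensor) : t = \sum_(p <- repr t) tens p.1 p.2.
Proof.
rewrite -{1}[t]reprK; elim: (repr t) => [|[u v] s IHs]; first by rewrite big_nil.
by rewrite big_cons -IHs -cat1s -tens_addE.
Qed.

(* Evaluation of Sweedler notation: \sum f t_1 t_2 for t = \sum t_1 ⊗ t_2. It uses
   a chosen representative of t, hence is meaningful only for bilinear f, in
   which case it is the linear map induced by f. *)
Definition tsum (W : lmodType K) (f : U -> V -> W) (t : tensor) : W :=
  \sum_(p <- repr t) f p.1 p.2.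

Section Lift.
Variables (W : lmodType K) (f : U -> V -> W).
Hypothesis f_bilinear : bilinear_for *:%R *:%R f.

Let fl k u u' v : f (k *: u + u') v = k *: f u v + f u' v.
Proof. exact: (f_bilinear.1 v). Qed.

Let fr k u v v' : f u (k *: v + v') = k *: f u v + f u v'.
Proof. exact: (f_bilinear.2 u). Qed.

Let f0l v : f 0 v = 0.
Proof. by have := fl (-1) 0 0 v; rewrite scaler0 addr0 scaleN1r addNr. Qed.

Let f0r u : f u 0 = 0.
Proof. by have := fr (-1) u 0 0; rewrite scaler0 addr0 scaleN1r addNr. Qed.

Lemma tsum_pi s : tsum f (\pi_tensor s) = \sum_(p <- s) f p.1 p.2.
Proof.
suff sumE s1 s2 : tens_eq s1 s2 ->
    \sum_(p <- s1) f p.1 p.2 = \sum_(p <- s2) f p.1 p.2.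
  by rewrite /tsum (sumE _ _ (tens_repr s)).
elim=> {s1 s2} //=.
- by move=> s1 s2 s3 _ -> _ ->.
- by move=> s1 s1' s2 s2' _ IHs _ IHt; rewrite !big_cat /= IHs IHt.
- by move=> s1 s2; rewrite !big_cat /= addrC.
- move=> u u' v; rewrite !big_cons !big_nil /= !addr0.
  by have := fl 1 u u' v; rewrite !scale1r.
- move=> u v v'; rewrite !big_cons !big_nil /= !addr0.
  by have := fr 1 u v v'; rewrite !scale1r.
- move=> k u v; rewrite !big_cons !big_nil /= !addr0.
  by have := fl k u 0 v; have := fr k u v 0; rewrite f0l f0r !addr0 => -> ->.
- by move=> v; rewrite big_cons big_nil addr0.
Qed.

Lemma tsum_tens u v : tsum f (tens u v) = f u v.
Proof. by rewrite tsum_pi big_cons big_nil addr0. Qed.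

Lemma tsum_linear : linear (tsum f).
Proof.
move=> k t t'; elim/tens_ind: t => s; elim/tens_ind: t' => s'.
have -> : k *: \pi_tensor s + \pi_tensor s' =
          \pi_tensor (tens_scale_seq k s ++ s').
  by rewrite -tens_addE -tens_zmulE.
rewrite !tsum_pi big_cat /= big_map; congr (_ + _).
rewrite scaler_sumr; apply: eq_bigr => -[u v] _ /=.
by have := fl k u 0 v; rewrite f0l !addr0.
Qed.

Lemma tsum_unique (g : {linear tensor -> W}) :
  (forall u v, g (tens u v) = f u v) -> g =1 tsum f.
Proof.
by move=> gf t; rewrite {1}[t]tensor_sum linear_sum; apply: eq_bigr.
Qed.
End Lift.
End Tensor.

Notation "U ⊗ V" := (tensor U%type V%type) (at level 40, left associativity) : type_scope.
Notation "u ⊗ v" := (tens u v) (at level 40, left associativity) : ring_scope.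
Notation "\Sw[ u , v <- t ] E" := (tsum (fun u v => E) t)
  (at level 41, u name, v name, t at level 200, E at level 41, right associativity,
   format "\Sw[ u ,  v  <-  t ]  E") : ring_scope.

Section TensorOps.
Variable K : fieldType.
Implicit Types U V W : lmodType K.

Definition tmap U V U' V' (f : U -> U') (g : V -> V') (t : U ⊗ V) : U' ⊗ V' :=
  \Sw[u, v <- t] f u ⊗ g v.

Lemma tmap_linear U V U' V' (f : {linear U -> U'}) (g : {linear V -> V'}) :
  linear (tmap f g).
Proof.
apply: tsum_linear; split=> [v | u] k x y /=.
  by rewrite linearP linearPl.
by rewrite linearP linearPr.
Qed.

(* u ⊗ t in U ⊗ (V ⊗ W), read in U ⊗ V ⊗ W = (U ⊗ V) ⊗ W *)
Definition tensA U V W (u : U) (t : V ⊗ W) : U ⊗ V ⊗ W :=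
  \Sw[v, w <- t] u ⊗ v ⊗ w.

Definition tau U V (t : U ⊗ V) : V ⊗ U := \Sw[u, v <- t] v ⊗ u.

Definition skew U (t : U ⊗ U) : U ⊗ U := t - tau t.

Definition tau12 U V W (t : U ⊗ V ⊗ W) : V ⊗ U ⊗ W := \Sw[s, w <- t] tau s ⊗ w.

Definition tau12_fixed U W (t : U ⊗ U ⊗ W) : Prop := tau12 t = t.

Definition symmetric12 (S T R : Type) (f : S -> S -> T -> R) : Prop :=
  forall x y z, f x y z = f y x z.

Definition commutator V (m : V -> V -> V) (x y : V) : V := m x y - m y x.

End TensorOps.

Notation "u ⊗: t" := (tensA u t) (at level 40, left associativity) : ring_scope.

Section LeftSymmetricBialgebra.
Variables (K : fieldType) (V : lmodType K).
Variables (m : {bilinear V -> V -> V}) (D : {linear V -> (V ⊗ V)%type}).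

Definition left_symmetric_algebra : Prop :=
  forall a b c, m (m a b) c - m a (m b c) = m (m b a) c - m b (m a c).

Definition left_symmetric_coalgebra : Prop :=
  forall c, tau12_fixed (\Sw[c1, c2 <- D c] D c1 ⊗ c2 - \Sw[c1, c2 <- D c] c1 ⊗: D c2).

Record left_symmetric_bialgebra : Prop := {
  lsb_algebra : left_symmetric_algebra;
  lsb_coalgebra : left_symmetric_coalgebra;
  lsb_bracket : forall a b,
    D (commutator m a b)
  = \Sw[b1, b2 <- D b] m a b1 ⊗ b2
    + \Sw[b1, b2 <- D b] b1 ⊗ commutator m a b2
    - \Sw[a1, a2 <- D a] m b a1 ⊗ a2
    - \Sw[a1, a2 <- D a] a1 ⊗ commutator m b a2;
  lsb_mul : forall a b,
    skew (D (m a b))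
  = skew (
      \Sw[a1, a2 <- D a] a1 ⊗ m a2 b
      + \Sw[b1, b2 <- D b] m a b1 ⊗ b2
      + \Sw[b1, b2 <- D b] b1 ⊗ m a b2)
}.

End LeftSymmetricBialgebra.

Record cross_data (K : fieldType) (A H : lmodType K) := CrossData {
  cd_mulA : {bilinear A -> A -> A};
  cd_mulH : {bilinear H -> H -> H};
  cd_comulA : {linear A -> (A ⊗ A)%type};
  cd_comulH : {linear H -> (H ⊗ H)%type};
  cd_ract : {bilinear H -> A -> A};  (* x ⇀ a *)
  cd_lact : {bilinear A -> H -> A};  (* a ↼ x *)
  cd_rtri : {bilinear A -> H -> H};  (* a ▷ x *)
  cd_ltri : {bilinear H -> A -> H};  (* x ◁ a *)
  cd_sigma : {bilinear H -> H -> A};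
  cd_theta : {bilinear A -> A -> H};
  cd_phi : {linear A -> (H ⊗ A)%type};
  cd_psi : {linear A -> (A ⊗ H)%type};
  cd_rho : {linear H -> (A ⊗ H)%type};
  cd_gamma : {linear H -> (H ⊗ A)%type};
  cd_P : {linear A -> (H ⊗ H)%type};
  cd_Q : {linear H -> (A ⊗ A)%type}
}.

Section CrossSystems.
Variables (K : fieldType) (A H : lmodType K) (E : cross_data A H).

Local Notation "a ∙ b" := (cd_mulA E a b) (at level 35, no associativity).
Local Notation "x ∗ y" := (cd_mulH E x y) (at level 35, no associativity).
Local Notation "x ⇀ a" := (cd_ract E x a) (at level 35, no associativity).
Local Notation "a ↼ x" := (cd_lact E a x) (at level 35, no associativity).
Local Notation "a ▷ x" := (cd_rtri E a x) (at level 35, no associativity).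
Local Notation "x ◁ a" := (cd_ltri E x a) (at level 35, no associativity).
Local Notation ΔA := (cd_comulA E).
Local Notation ΔH := (cd_comulH E).
Local Notation σ := (cd_sigma E).
Local Notation θ := (cd_theta E).
Local Notation φ := (cd_phi E).
Local Notation ψ := (cd_psi E).
Local Notation ρ := (cd_rho E).
Local Notation γ := (cd_gamma E).
Local Notation P := (cd_P E).
Local Notation Q := (cd_Q E).
Local Notation brA := (commutator (cd_mulA E)).
Local Notation brH := (commutator (cd_mulH E)).

(* Legs of the structure maps, for a in A (and likewise for b) and x in H (y):
   ΔA a = a1 ⊗ a2,  φ a = am1 ⊗ a0,  ψ a = a0 ⊗ a1,  P a = ap1 ⊗ ap2,
   ΔH x = x1 ⊗ x2,  ρ x = xm1 ⊗ x0,  γ x = x0 ⊗ x1,  Q x = xq1 ⊗ xq2. *)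

Definition sigma_left_symmetric_algebra : Prop :=
  symmetric12 (fun x y z =>
    (x ∗ y) ∗ z - x ∗ (y ∗ z) + σ x y ▷ z - x ◁ σ y z).

Definition theta_left_symmetric_algebra : Prop :=
  symmetric12 (fun a b c =>
    (a ∙ b) ∙ c - a ∙ (b ∙ c) + θ a b ⇀ c - a ↼ θ b c).

Definition P_left_symmetric_coalgebra : Prop :=
  forall x, tau12_fixed (
    \Sw[x1, x2 <- ΔH x] ΔH x1 ⊗ x2
    - \Sw[x1, x2 <- ΔH x] x1 ⊗: ΔH x2
    + \Sw[xm1, x0 <- ρ x] P xm1 ⊗ x0
    - \Sw[x0, x1 <- γ x] x0 ⊗: P x1).

Definition Q_left_symmetric_coalgebra : Prop :=
  forall a, tau12_fixed (
    \Sw[a1, a2 <- ΔA a] ΔA a1 ⊗ a2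
    - \Sw[a1, a2 <- ΔA a] a1 ⊗: ΔA a2
    + \Sw[am1, a0 <- φ a] Q am1 ⊗ a0
    - \Sw[a0, a1 <- ψ a] a0 ⊗: Q a1).

(* In the field names below, e.g. AAH_H is the H-component of left symmetry on
   A, A, H; dually, in a coproduct system, AAH_H is the A ⊗ A ⊗ H-component on H;
   and bracket_HA_AH is the A ⊗ H-component of the coproduct of [x, b]. *)
Record cocycle_cross_product_system : Prop := {
  ccp_sigma_cocycle : symmetric12 (fun x y z =>
    σ (x ∗ y) z - σ x (y ∗ z) + σ x y ↼ z - x ⇀ σ y z);
  ccp_theta_cocycle : symmetric12 (fun a b c =>
    θ (a ∙ b) c - θ a (b ∙ c) + θ a b ◁ c - a ▷ θ b c);
  ccp_sigma_left_symmetric : sigma_left_symmetric_algebra;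
  ccp_theta_left_symmetric : theta_left_symmetric_algebra;
  ccp_AAH_H : forall a b x,
    brA a b ▷ x + (θ a b - θ b a) ∗ x
  = a ▷ (b ▷ x) - b ▷ (a ▷ x) + θ a (b ↼ x) - θ b (a ↼ x);
  ccp_HAA_H : forall a b x,
    x ◁ (a ∙ b) + x ∗ θ a b
  = a ▷ (x ◁ b) + (x ◁ a - a ▷ x) ◁ b + θ (x ⇀ a - a ↼ x) b + θ a (x ⇀ b);
  ccp_AHH_H : forall a x y,
    a ▷ (x ∗ y) + θ a (σ x y)
  = (a ▷ x - x ◁ a) ∗ y + (a ↼ x - x ⇀ a) ▷ y + x ◁ (a ↼ y) + x ∗ (a ▷ y);
  ccp_HHA_H : forall x y a,
    brH x y ◁ a + θ (σ x y - σ y x) a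
  = x ◁ (y ⇀ a) - y ◁ (x ⇀ a) + x ∗ (y ◁ a) - y ∗ (x ◁ a);
  ccp_HHA_A : forall x y a,
    brH x y ⇀ a + (σ x y - σ y x) ∙ a
  = x ⇀ (y ⇀ a) - y ⇀ (x ⇀ a) + σ x (y ◁ a) - σ y (x ◁ a);
  ccp_AHH_A : forall a x y,
    a ↼ (x ∗ y) + a ∙ σ x y
  = x ⇀ (a ↼ y) + (a ↼ x - x ⇀ a) ↼ y + σ (a ▷ x - x ◁ a) y + σ x (a ▷ y);
  ccp_HAA_A : forall x a b,
    x ⇀ (a ∙ b) + σ x (θ a b)
  = (x ⇀ a - a ↼ x) ∙ b + (x ◁ a - a ▷ x) ⇀ b + a ∙ (x ⇀ b) + a ↼ (x ◁ b);
  ccp_AAH_A : forall a b x,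
    brA a b ↼ x + σ (θ a b - θ b a) x
  = a ∙ (b ↼ x) + a ↼ (b ▷ x) - b ∙ (a ↼ x) - b ↼ (a ▷ x)
}.

Record cycle_cross_coproduct_system : Prop := {
  ccc_P_cycle : forall a, tau12_fixed (
    \Sw[ap1, ap2 <- P a] ΔH ap1 ⊗ ap2
    - \Sw[ap1, ap2 <- P a] ap1 ⊗: ΔH ap2
    + \Sw[a0, a1 <- ψ a] P a0 ⊗ a1
    - \Sw[am1, a0 <- φ a] am1 ⊗: P a0);
  ccc_Q_cycle : forall x, tau12_fixed (
    \Sw[xq1, xq2 <- Q x] ΔA xq1 ⊗ xq2
    - \Sw[xq1, xq2 <- Q x] xq1 ⊗: ΔA xq2
    + \Sw[x0, x1 <- γ x] Q x0 ⊗ x1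
    - \Sw[xm1, x0 <- ρ x] xm1 ⊗: Q x0);
  ccc_P_left_symmetric : P_left_symmetric_coalgebra;
  ccc_Q_left_symmetric : Q_left_symmetric_coalgebra;
  ccc_AAH_A : forall a, tau12_fixed (
    \Sw[a0, a1 <- ψ a] ΔA a0 ⊗ a1
    + \Sw[ap1, ap2 <- P a] Q ap1 ⊗ ap2
    - \Sw[a1, a2 <- ΔA a] a1 ⊗: ψ a2
    - \Sw[a0, a1 <- ψ a] a0 ⊗: ρ a1);
  ccc_HHA_H : forall x, tau12_fixed (
    \Sw[x0, x1 <- γ x] ΔH x0 ⊗ x1
    + \Sw[xq1, xq2 <- Q x] P xq1 ⊗ xq2
    - \Sw[x0, x1 <- γ x] x0 ⊗: φ x1
    - \Sw[x1, x2 <- ΔH x] x1 ⊗: γ x2);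
  ccc_HHA_A : forall a, tau12_fixed (
    \Sw[am1, a0 <- φ a] ΔH am1 ⊗ a0
    + \Sw[a1, a2 <- ΔA a] P a1 ⊗ a2
    - \Sw[am1, a0 <- φ a] am1 ⊗: φ a0
    - \Sw[ap1, ap2 <- P a] ap1 ⊗: γ ap2);
  ccc_AAH_H : forall x, tau12_fixed (
    \Sw[xm1, x0 <- ρ x] xm1 ⊗: ρ x0
    + \Sw[xq1, xq2 <- Q x] xq1 ⊗: ψ xq2
    - \Sw[xm1, x0 <- ρ x] ΔA xm1 ⊗ x0
    - \Sw[x1, x2 <- ΔH x] Q x1 ⊗ x2);
  ccc_HAA_A : forall a,
    \Sw[a1, a2 <- ΔA a] φ a1 ⊗ a2
    + \Sw[am1, a0 <- φ a] γ am1 ⊗ a0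
    - \Sw[am1, a0 <- φ a] am1 ⊗: ΔA a0
    - \Sw[ap1, ap2 <- P a] ap1 ⊗: Q ap2
  = tau12 (
      \Sw[a1, a2 <- ΔA a] ψ a1 ⊗ a2
      + \Sw[am1, a0 <- φ a] ρ am1 ⊗ a0
      - \Sw[a1, a2 <- ΔA a] a1 ⊗: φ a2
      - \Sw[a0, a1 <- ψ a] a0 ⊗: γ a1);
  ccc_AHH_H : forall x,
    \Sw[x1, x2 <- ΔH x] ρ x1 ⊗ x2
    + \Sw[xm1, x0 <- ρ x] ψ xm1 ⊗ x0
    - \Sw[xm1, x0 <- ρ x] xm1 ⊗: ΔH x0
    - \Sw[xq1, xq2 <- Q x] xq1 ⊗: P xq2
  = tau12 (
      \Sw[x1, x2 <- ΔH x] γ x1 ⊗ x2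
      + \Sw[xm1, x0 <- ρ x] φ xm1 ⊗ x0
      - \Sw[x0, x1 <- γ x] x0 ⊗: ψ x1
      - \Sw[x1, x2 <- ΔH x] x1 ⊗: ρ x2);
  ccc_AHH_A : forall a,
    \Sw[a0, a1 <- ψ a] a0 ⊗: ΔH a1
    + \Sw[a1, a2 <- ΔA a] a1 ⊗: P a2
    - \Sw[a0, a1 <- ψ a] ψ a0 ⊗ a1
    - \Sw[ap1, ap2 <- P a] ρ ap1 ⊗ ap2
  = tau12 (
      \Sw[am1, a0 <- φ a] am1 ⊗: ψ a0
      + \Sw[ap1, ap2 <- P a] ap1 ⊗: ρ ap2
      - \Sw[a0, a1 <- ψ a] φ a0 ⊗ a1
      - \Sw[ap1, ap2 <- P a] γ ap1 ⊗ ap2);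
  ccc_HAA_H : forall x,
    \Sw[x0, x1 <- γ x] x0 ⊗: ΔA x1
    + \Sw[x1, x2 <- ΔH x] x1 ⊗: Q x2
    - \Sw[x0, x1 <- γ x] γ x0 ⊗ x1
    - \Sw[xq1, xq2 <- Q x] φ xq1 ⊗ xq2
  = tau12 (
      \Sw[xm1, x0 <- ρ x] xm1 ⊗: γ x0
      + \Sw[xq1, xq2 <- Q x] xq1 ⊗: φ xq2
      - \Sw[x0, x1 <- γ x] ρ x0 ⊗ x1
      - \Sw[xq1, xq2 <- Q x] ψ xq1 ⊗ xq2)
}.

Record cocycle_double_matched_pair : Prop := {
  cdm_bracket_AA_HA : forall a b,
    φ (brA a b) + γ (θ a b - θ b a)
  = \Sw[am1, a0 <- φ a] am1 ⊗ brA a0 b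
    + \Sw[bm1, b0 <- φ b] (a ▷ bm1) ⊗ b0
    + \Sw[ap1, ap2 <- P a] ap1 ⊗ (ap2 ⇀ b)
    + \Sw[b1, b2 <- ΔA b] θ a b1 ⊗ b2
    + \Sw[bm1, b0 <- φ b] bm1 ⊗ brA a b0
    + \Sw[bp1, bp2 <- P b] bp1 ⊗ (a ↼ bp2)
    - \Sw[am1, a0 <- φ a] (b ▷ am1) ⊗ a0
    - \Sw[bp1, bp2 <- P b] bp1 ⊗ (bp2 ⇀ a)
    - \Sw[a1, a2 <- ΔA a] θ b a1 ⊗ a2
    - \Sw[ap1, ap2 <- P a] ap1 ⊗ (b ↼ ap2);
  cdm_bracket_AA_AH : forall a b,
    ψ (brA a b) + ρ (θ a b - θ b a)
  = \Sw[b0, b1 <- ψ b] (a ∙ b0) ⊗ b1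
    + \Sw[a0, a1 <- ψ a] a0 ⊗ (a1 ◁ b)
    + \Sw[bp1, bp2 <- P b] (a ↼ bp1) ⊗ bp2
    + \Sw[a1, a2 <- ΔA a] a1 ⊗ θ a2 b
    + \Sw[b0, b1 <- ψ b] b0 ⊗ (a ▷ b1)
    + \Sw[b1, b2 <- ΔA b] b1 ⊗ θ a b2
    - \Sw[a0, a1 <- ψ a] (b ∙ a0) ⊗ a1
    - \Sw[b0, b1 <- ψ b] b0 ⊗ (b1 ◁ a)
    - \Sw[ap1, ap2 <- P a] (b ↼ ap1) ⊗ ap2
    - \Sw[b1, b2 <- ΔA b] b1 ⊗ θ b2 a
    - \Sw[a0, a1 <- ψ a] a0 ⊗ (b ▷ a1)
    - \Sw[a1, a2 <- ΔA a] a1 ⊗ θ b a2;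
  cdm_bracket_HH_AH : forall x y,
    ρ (brH x y) + ψ (σ x y - σ y x)
  = \Sw[xm1, x0 <- ρ x] xm1 ⊗ brH x0 y
    + \Sw[ym1, y0 <- ρ y] (x ⇀ ym1) ⊗ y0
    + \Sw[xq1, xq2 <- Q x] xq1 ⊗ (xq2 ▷ y)
    + \Sw[y1, y2 <- ΔH y] σ x y1 ⊗ y2
    + \Sw[ym1, y0 <- ρ y] ym1 ⊗ brH x y0
    + \Sw[yq1, yq2 <- Q y] yq1 ⊗ (x ◁ yq2)
    - \Sw[xm1, x0 <- ρ x] (y ⇀ xm1) ⊗ x0
    - \Sw[yq1, yq2 <- Q y] yq1 ⊗ (yq2 ▷ x)
    - \Sw[x1, x2 <- ΔH x] σ y x1 ⊗ x2
    - \Sw[xq1, xq2 <- Q x] xq1 ⊗ (y ◁ xq2);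
  cdm_bracket_HH_HA : forall x y,
    γ (brH x y) + φ (σ x y - σ y x)
  = \Sw[x0, x1 <- γ x] x0 ⊗ (x1 ↼ y)
    + \Sw[y0, y1 <- γ y] (x ∗ y0) ⊗ y1
    + \Sw[x1, x2 <- ΔH x] x1 ⊗ σ x2 y
    + \Sw[yq1, yq2 <- Q y] (x ◁ yq1) ⊗ yq2
    + \Sw[y1, y2 <- ΔH y] y1 ⊗ σ x y2
    + \Sw[y0, y1 <- γ y] y0 ⊗ (x ⇀ y1)
    - \Sw[y0, y1 <- γ y] y0 ⊗ (y1 ↼ x)
    - \Sw[x0, x1 <- γ x] (y ∗ x0) ⊗ x1
    - \Sw[y1, y2 <- ΔH y] y1 ⊗ σ y2 x
    - \Sw[xq1, xq2 <- Q x] (y ◁ xq1) ⊗ xq2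
    - \Sw[x1, x2 <- ΔH x] x1 ⊗ σ y x2
    - \Sw[x0, x1 <- γ x] x0 ⊗ (y ⇀ x1);
  cdm_bracket_HA_AA : forall x b,
    ΔA (x ⇀ b) - ΔA (b ↼ x) + Q (x ◁ b) - Q (b ▷ x)
  = \Sw[xm1, x0 <- ρ x] xm1 ⊗ (x0 ⇀ b)
    + \Sw[b1, b2 <- ΔA b] (x ⇀ b1) ⊗ b2
    + \Sw[xq1, xq2 <- Q x] xq1 ⊗ brA xq2 b
    + \Sw[bm1, b0 <- φ b] σ x bm1 ⊗ b0
    + \Sw[b1, b2 <- ΔA b] b1 ⊗ (x ⇀ b2)
    + \Sw[b0, b1 <- ψ b] b0 ⊗ σ x b1
    - \Sw[b1, b2 <- ΔA b] b1 ⊗ (b2 ↼ x)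
    - \Sw[x0, x1 <- γ x] (b ↼ x0) ⊗ x1
    - \Sw[b0, b1 <- ψ b] b0 ⊗ σ b1 x
    - \Sw[xq1, xq2 <- Q x] (b ∙ xq1) ⊗ xq2
    - \Sw[xm1, x0 <- ρ x] xm1 ⊗ (b ↼ x0);
  cdm_bracket_AH_HH : forall a y,
    ΔH (a ▷ y) - ΔH (y ◁ a) + P (a ↼ y) - P (y ⇀ a)
  = \Sw[am1, a0 <- φ a] am1 ⊗ (a0 ▷ y)
    + \Sw[y1, y2 <- ΔH y] (a ▷ y1) ⊗ y2
    + \Sw[ap1, ap2 <- P a] ap1 ⊗ brH ap2 y
    + \Sw[ym1, y0 <- ρ y] θ a ym1 ⊗ y0
    + \Sw[y1, y2 <- ΔH y] y1 ⊗ (a ▷ y2)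
    + \Sw[y0, y1 <- γ y] y0 ⊗ θ a y1
    - \Sw[y1, y2 <- ΔH y] y1 ⊗ (y2 ◁ a)
    - \Sw[a0, a1 <- ψ a] (y ◁ a0) ⊗ a1
    - \Sw[y0, y1 <- γ y] y0 ⊗ θ y1 a
    - \Sw[ap1, ap2 <- P a] (y ∗ ap1) ⊗ ap2
    - \Sw[am1, a0 <- φ a] am1 ⊗ (y ◁ a0);
  cdm_bracket_AA_HH : forall a b,
    ΔH (θ a b - θ b a) + P (brA a b)
  = \Sw[am1, a0 <- φ a] am1 ⊗ θ a0 b
    + \Sw[ap1, ap2 <- P a] ap1 ⊗ (ap2 ◁ b)
    + \Sw[b0, b1 <- ψ b] θ a b0 ⊗ b1
    + \Sw[bp1, bp2 <- P b] (a ▷ bp1) ⊗ bp2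
    + \Sw[bm1, b0 <- φ b] bm1 ⊗ θ a b0
    + \Sw[bp1, bp2 <- P b] bp1 ⊗ (a ▷ bp2)
    - \Sw[bm1, b0 <- φ b] bm1 ⊗ θ b0 a
    - \Sw[bp1, bp2 <- P b] bp1 ⊗ (bp2 ◁ a)
    - \Sw[a0, a1 <- ψ a] θ b a0 ⊗ a1
    - \Sw[ap1, ap2 <- P a] (b ▷ ap1) ⊗ ap2
    - \Sw[am1, a0 <- φ a] am1 ⊗ θ b a0
    - \Sw[ap1, ap2 <- P a] ap1 ⊗ (b ▷ ap2);
  cdm_bracket_HH_AA : forall x y,
    ΔA (σ x y - σ y x) + Q (brH x y)
  = \Sw[xm1, x0 <- ρ x] xm1 ⊗ σ x0 y
    + \Sw[xq1, xq2 <- Q x] xq1 ⊗ (xq2 ↼ y)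
    + \Sw[y0, y1 <- γ y] σ x y0 ⊗ y1
    + \Sw[yq1, yq2 <- Q y] (x ⇀ yq1) ⊗ yq2
    + \Sw[ym1, y0 <- ρ y] ym1 ⊗ σ x y0
    + \Sw[yq1, yq2 <- Q y] yq1 ⊗ (x ⇀ yq2)
    - \Sw[ym1, y0 <- ρ y] ym1 ⊗ σ y0 x
    - \Sw[yq1, yq2 <- Q y] yq1 ⊗ (yq2 ↼ x)
    - \Sw[x0, x1 <- γ x] σ y x0 ⊗ x1
    - \Sw[xq1, xq2 <- Q x] (y ⇀ xq1) ⊗ xq2
    - \Sw[xm1, x0 <- ρ x] xm1 ⊗ σ y x0
    - \Sw[xq1, xq2 <- Q x] xq1 ⊗ (y ⇀ xq2);
  cdm_bracket_HA_HA : forall x b,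
    φ (x ⇀ b) - φ (b ↼ x) + γ (x ◁ b) - γ (b ▷ x)
  = \Sw[x1, x2 <- ΔH x] x1 ⊗ (x2 ⇀ b)
    + \Sw[bm1, b0 <- φ b] (x ∗ bm1) ⊗ b0
    + \Sw[x0, x1 <- γ x] x0 ⊗ brA x1 b
    + \Sw[b1, b2 <- ΔA b] (x ◁ b1) ⊗ b2
    + \Sw[bm1, b0 <- φ b] bm1 ⊗ (x ⇀ b0)
    + \Sw[bp1, bp2 <- P b] bp1 ⊗ σ x bp2
    - \Sw[bm1, b0 <- φ b] bm1 ⊗ (b0 ↼ x)
    - \Sw[xq1, xq2 <- Q x] θ b xq1 ⊗ xq2
    - \Sw[x0, x1 <- γ x] (b ▷ x0) ⊗ x1
    - \Sw[bp1, bp2 <- P b] bp1 ⊗ σ bp2 x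
    - \Sw[x1, x2 <- ΔH x] x1 ⊗ (b ↼ x2);
  cdm_bracket_HA_AH : forall x b,
    ψ (x ⇀ b) - ψ (b ↼ x) + ρ (x ◁ b) - ρ (b ▷ x)
  = \Sw[b0, b1 <- ψ b] (x ⇀ b0) ⊗ b1
    + \Sw[xq1, xq2 <- Q x] xq1 ⊗ θ xq2 b
    + \Sw[xm1, x0 <- ρ x] xm1 ⊗ (x0 ◁ b)
    + \Sw[bp1, bp2 <- P b] σ x bp1 ⊗ bp2
    + \Sw[b1, b2 <- ΔA b] b1 ⊗ (x ◁ b2)
    + \Sw[b0, b1 <- ψ b] b0 ⊗ brH x b1
    - \Sw[x1, x2 <- ΔH x] (b ↼ x1) ⊗ x2
    - \Sw[b1, b2 <- ΔA b] b1 ⊗ (b2 ▷ x)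
    - \Sw[xm1, x0 <- ρ x] (b ∙ xm1) ⊗ x0
    - \Sw[xm1, x0 <- ρ x] xm1 ⊗ (b ▷ x0)
    - \Sw[xq1, xq2 <- Q x] xq1 ⊗ θ b xq2;
  cdm_mul_AA_HA : forall a b,
    φ (a ∙ b) + γ (θ a b) - tau (ψ (a ∙ b)) - tau (ρ (θ a b))
  = \Sw[am1, a0 <- φ a] am1 ⊗ (a0 ∙ b)
    + \Sw[bm1, b0 <- φ b] (a ▷ bm1) ⊗ b0
    + \Sw[ap1, ap2 <- P a] ap1 ⊗ (ap2 ⇀ b)
    + \Sw[b1, b2 <- ΔA b] θ a b1 ⊗ b2
    + \Sw[bm1, b0 <- φ b] bm1 ⊗ (a ∙ b0)
    + \Sw[bp1, bp2 <- P b] bp1 ⊗ (a ↼ bp2)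
    - tau (
      \Sw[b0, b1 <- ψ b] (a ∙ b0) ⊗ b1
      + \Sw[a0, a1 <- ψ a] a0 ⊗ (a1 ◁ b)
      + \Sw[bp1, bp2 <- P b] (a ↼ bp1) ⊗ bp2
      + \Sw[a1, a2 <- ΔA a] a1 ⊗ θ a2 b
      + \Sw[b0, b1 <- ψ b] b0 ⊗ (a ▷ b1)
      + \Sw[b1, b2 <- ΔA b] b1 ⊗ θ a b2);
  cdm_mul_HH_AH : forall x y,
    ρ (x ∗ y) + ψ (σ x y) - tau (γ (x ∗ y)) - tau (φ (σ x y))
  = \Sw[xm1, x0 <- ρ x] xm1 ⊗ (x0 ∗ y)
    + \Sw[ym1, y0 <- ρ y] (x ⇀ ym1) ⊗ y0
    + \Sw[xq1, xq2 <- Q x] xq1 ⊗ (xq2 ▷ y)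
    + \Sw[y1, y2 <- ΔH y] σ x y1 ⊗ y2
    + \Sw[ym1, y0 <- ρ y] ym1 ⊗ (x ∗ y0)
    + \Sw[yq1, yq2 <- Q y] yq1 ⊗ (x ◁ yq2)
    - tau (
      \Sw[x0, x1 <- γ x] x0 ⊗ (x1 ↼ y)
      + \Sw[y0, y1 <- γ y] (x ∗ y0) ⊗ y1
      + \Sw[x1, x2 <- ΔH x] x1 ⊗ σ x2 y
      + \Sw[yq1, yq2 <- Q y] (x ◁ yq1) ⊗ yq2
      + \Sw[y1, y2 <- ΔH y] y1 ⊗ σ x y2
      + \Sw[y0, y1 <- γ y] y0 ⊗ (x ⇀ y1));
  cdm_mul_HA_AA : forall x b,
    skew (ΔA (x ⇀ b) + Q (x ◁ b))
  = skew (
      \Sw[xm1, x0 <- ρ x] xm1 ⊗ (x0 ⇀ b)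
      + \Sw[b1, b2 <- ΔA b] (x ⇀ b1) ⊗ b2
      + \Sw[xq1, xq2 <- Q x] xq1 ⊗ (xq2 ∙ b)
      + \Sw[bm1, b0 <- φ b] σ x bm1 ⊗ b0
      + \Sw[b1, b2 <- ΔA b] b1 ⊗ (x ⇀ b2)
      + \Sw[b0, b1 <- ψ b] b0 ⊗ σ x b1);
  cdm_mul_AH_AA : forall a y,
    skew (ΔA (a ↼ y) + Q (a ▷ y))
  = skew (
      \Sw[a1, a2 <- ΔA a] a1 ⊗ (a2 ↼ y)
      + \Sw[y0, y1 <- γ y] (a ↼ y0) ⊗ y1
      + \Sw[a0, a1 <- ψ a] a0 ⊗ σ a1 y
      + \Sw[yq1, yq2 <- Q y] (a ∙ yq1) ⊗ yq2
      + \Sw[ym1, y0 <- ρ y] ym1 ⊗ (a ↼ y0)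
      + \Sw[yq1, yq2 <- Q y] yq1 ⊗ (a ∙ yq2));
  cdm_mul_AH_HH : forall a y,
    skew (ΔH (a ▷ y) + P (a ↼ y))
  = skew (
      \Sw[am1, a0 <- φ a] am1 ⊗ (a0 ▷ y)
      + \Sw[y1, y2 <- ΔH y] (a ▷ y1) ⊗ y2
      + \Sw[ap1, ap2 <- P a] ap1 ⊗ (ap2 ∗ y)
      + \Sw[ym1, y0 <- ρ y] θ a ym1 ⊗ y0
      + \Sw[y1, y2 <- ΔH y] y1 ⊗ (a ▷ y2)
      + \Sw[y0, y1 <- γ y] y0 ⊗ θ a y1);
  cdm_mul_HA_HH : forall x b,
    skew (ΔH (x ◁ b) + P (x ⇀ b))
  = skew (
      \Sw[x1, x2 <- ΔH x] x1 ⊗ (x2 ◁ b)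
      + \Sw[b0, b1 <- ψ b] (x ◁ b0) ⊗ b1
      + \Sw[x0, x1 <- γ x] x0 ⊗ θ x1 b
      + \Sw[bp1, bp2 <- P b] (x ∗ bp1) ⊗ bp2
      + \Sw[bp1, bp2 <- P b] bp1 ⊗ (x ∗ bp2)
      + \Sw[bm1, b0 <- φ b] bm1 ⊗ (x ◁ b0));
  cdm_mul_AA_HH : forall a b,
    skew (ΔH (θ a b) + P (a ∙ b))
  = skew (
      \Sw[am1, a0 <- φ a] am1 ⊗ θ a0 b
      + \Sw[ap1, ap2 <- P a] ap1 ⊗ (ap2 ◁ b)
      + \Sw[b0, b1 <- ψ b] θ a b0 ⊗ b1
      + \Sw[bp1, bp2 <- P b] (a ▷ bp1) ⊗ bp2
      + \Sw[bm1, b0 <- φ b] bm1 ⊗ θ a b0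
      + \Sw[bp1, bp2 <- P b] bp1 ⊗ (a ▷ bp2));
  cdm_mul_HH_AA : forall x y,
    skew (ΔA (σ x y) + Q (x ∗ y))
  = skew (
      \Sw[xm1, x0 <- ρ x] xm1 ⊗ σ x0 y
      + \Sw[xq1, xq2 <- Q x] xq1 ⊗ (xq2 ↼ y)
      + \Sw[y0, y1 <- γ y] σ x y0 ⊗ y1
      + \Sw[yq1, yq2 <- Q y] (x ⇀ yq1) ⊗ yq2
      + \Sw[ym1, y0 <- ρ y] ym1 ⊗ σ x y0
      + \Sw[yq1, yq2 <- Q y] yq1 ⊗ (x ⇀ yq2));
  cdm_mul_HA_HA : forall x b,
    φ (x ⇀ b) + γ (x ◁ b) - tau (ψ (x ⇀ b)) - tau (ρ (x ◁ b))
  = \Sw[x1, x2 <- ΔH x] x1 ⊗ (x2 ⇀ b)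
    + \Sw[bm1, b0 <- φ b] (x ∗ bm1) ⊗ b0
    + \Sw[x0, x1 <- γ x] x0 ⊗ (x1 ∙ b)
    + \Sw[b1, b2 <- ΔA b] (x ◁ b1) ⊗ b2
    + \Sw[bm1, b0 <- φ b] bm1 ⊗ (x ⇀ b0)
    + \Sw[bp1, bp2 <- P b] bp1 ⊗ σ x bp2
    - tau (
      \Sw[b0, b1 <- ψ b] (x ⇀ b0) ⊗ b1
      + \Sw[xq1, xq2 <- Q x] xq1 ⊗ θ xq2 b
      + \Sw[xm1, x0 <- ρ x] xm1 ⊗ (x0 ◁ b)
      + \Sw[bp1, bp2 <- P b] σ x bp1 ⊗ bp2
      + \Sw[b1, b2 <- ΔA b] b1 ⊗ (x ◁ b2)
      + \Sw[b0, b1 <- ψ b] b0 ⊗ (x ∗ b1));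
  cdm_mul_AH_AH : forall a y,
    ψ (a ↼ y) + ρ (a ▷ y) - tau (φ (a ↼ y)) - tau (γ (a ▷ y))
  = \Sw[a0, a1 <- ψ a] a0 ⊗ (a1 ∗ y)
    + \Sw[y1, y2 <- ΔH y] (a ↼ y1) ⊗ y2
    + \Sw[a1, a2 <- ΔA a] a1 ⊗ (a2 ▷ y)
    + \Sw[ym1, y0 <- ρ y] (a ∙ ym1) ⊗ y0
    + \Sw[ym1, y0 <- ρ y] ym1 ⊗ (a ▷ y0)
    + \Sw[yq1, yq2 <- Q y] yq1 ⊗ θ a yq2
    - tau (
      \Sw[am1, a0 <- φ a] am1 ⊗ (a0 ↼ y)
      + \Sw[yq1, yq2 <- Q y] θ a yq1 ⊗ yq2
      + \Sw[y0, y1 <- γ y] (a ▷ y0) ⊗ y1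
      + \Sw[ap1, ap2 <- P a] ap1 ⊗ σ ap2 y
      + \Sw[y1, y2 <- ΔH y] y1 ⊗ (a ↼ y2)
      + \Sw[y0, y1 <- γ y] y0 ⊗ (a ∙ y1))
}.

Record cocycle_braided_bialgebra_A : Prop := {
  cbA_algebra : theta_left_symmetric_algebra;
  cbA_coalgebra : Q_left_symmetric_coalgebra;
  cbA_bracket : forall a b,
    ΔA (brA a b) + Q (θ a b) - Q (θ b a)
  = \Sw[b1, b2 <- ΔA b] (a ∙ b1) ⊗ b2
    + \Sw[b1, b2 <- ΔA b] b1 ⊗ brA a b2
    - \Sw[a1, a2 <- ΔA a] (b ∙ a1) ⊗ a2
    - \Sw[a1, a2 <- ΔA a] a1 ⊗ brA b a2
    + \Sw[a0, a1 <- ψ a] a0 ⊗ (a1 ⇀ b)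
    + \Sw[bm1, b0 <- φ b] (a ↼ bm1) ⊗ b0
    + \Sw[b0, b1 <- ψ b] b0 ⊗ (a ↼ b1)
    - \Sw[b0, b1 <- ψ b] b0 ⊗ (b1 ⇀ a)
    - \Sw[am1, a0 <- φ a] (b ↼ am1) ⊗ a0
    - \Sw[a0, a1 <- ψ a] a0 ⊗ (b ↼ a1);
  cbA_mul : forall a b,
    skew (ΔA (a ∙ b) + Q (θ a b))
  = skew (
      \Sw[a1, a2 <- ΔA a] a1 ⊗ (a2 ∙ b)
      + \Sw[b1, b2 <- ΔA b] (a ∙ b1) ⊗ b2
      + \Sw[b1, b2 <- ΔA b] b1 ⊗ (a ∙ b2)
      + \Sw[a0, a1 <- ψ a] a0 ⊗ (a1 ⇀ b)
      + \Sw[bm1, b0 <- φ b] (a ↼ bm1) ⊗ b0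
      + \Sw[b0, b1 <- ψ b] b0 ⊗ (a ↼ b1))
}.

Record cocycle_braided_bialgebra_H : Prop := {
  cbH_algebra : sigma_left_symmetric_algebra;
  cbH_coalgebra : P_left_symmetric_coalgebra;
  cbH_bracket : forall x y,
    ΔH (brH x y) + P (σ x y) - P (σ y x)
  = \Sw[x1, x2 <- ΔH x] x1 ⊗ brH x2 y
    + \Sw[y1, y2 <- ΔH y] (x ∗ y1) ⊗ y2
    - \Sw[y1, y2 <- ΔH y] y1 ⊗ brH y2 x
    - \Sw[x1, x2 <- ΔH x] (y ∗ x1) ⊗ x2
    + \Sw[x0, x1 <- γ x] x0 ⊗ (x1 ▷ y)
    + \Sw[ym1, y0 <- ρ y] (x ◁ ym1) ⊗ y0
    + \Sw[y0, y1 <- γ y] y0 ⊗ (x ◁ y1)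
    - \Sw[y0, y1 <- γ y] y0 ⊗ (y1 ▷ x)
    - \Sw[xm1, x0 <- ρ x] (y ◁ xm1) ⊗ x0
    - \Sw[x0, x1 <- γ x] x0 ⊗ (y ◁ x1);
  cbH_mul : forall x y,
    skew (ΔH (x ∗ y) + P (σ x y))
  = skew (
      \Sw[x1, x2 <- ΔH x] x1 ⊗ (x2 ∗ y)
      + \Sw[y1, y2 <- ΔH y] (x ∗ y1) ⊗ y2
      + \Sw[y1, y2 <- ΔH y] y1 ⊗ (x ∗ y2)
      + \Sw[x0, x1 <- γ x] x0 ⊗ (x1 ▷ y)
      + \Sw[ym1, y0 <- ρ y] (x ◁ ym1) ⊗ y0
      + \Sw[y0, y1 <- γ y] y0 ⊗ (x ◁ y1))
}.

Definition dsum_mul (u v : A * H) : A * H :=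
  (u.1 ∙ v.1 + u.2 ⇀ v.1 + u.1 ↼ v.2 + σ u.2 v.2,
   u.2 ∗ v.2 + u.2 ◁ v.1 + u.1 ▷ v.2 + θ u.1 v.1).

Let addr4 (V : zmodType) (a a' b b' c c' d d' : V) :
  a + a' + (b + b') + (c + c') + (d + d') = a + b + c + d + (a' + b' + c' + d').
Proof. by rewrite (addrACA a) (addrACA (a + b)) (addrACA (a + b + c)). Qed.

Lemma dsum_mul_is_bilinear : bilinear_for *:%R *:%R dsum_mul.
Proof.
split=> [v | u] k x y; rewrite /dsum_mul /=.
  by rewrite !linearPl !addr4 -!scalerDr.
by rewrite !linearPr !addr4 -!scalerDr.
Qed.

HB.instance Definition _ := bilinear_isBilinear.Build K (A * H)%type (A * H)%type
  (A * H)%type *:%R *:%R dsum_mul dsum_mul_is_bilinear.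

Definition dsum_inA (a : A) : A * H := (a, 0).
Definition dsum_inH (x : H) : A * H := (0, x).

Lemma dsum_inA_linear : linear dsum_inA.
Proof. by move=> k a b; congr pair; rewrite /= scaler0 addr0. Qed.
Lemma dsum_inH_linear : linear dsum_inH.
Proof. by move=> k x y; congr pair; rewrite /= scaler0 addr0. Qed.
HB.instance Definition _ := GRing.isLinear.Build K A (A * H)%type *:%R
  dsum_inA dsum_inA_linear.
HB.instance Definition _ := GRing.isLinear.Build K H (A * H)%type *:%R
  dsum_inH dsum_inH_linear.

Definition dsum_comulA (a : A) : (A * H) ⊗ (A * H) :=
  tmap dsum_inA dsum_inA (ΔA a) + tmap dsum_inH dsum_inA (φ a)
  + tmap dsum_inA dsum_inH (ψ a) + tmap dsum_inH dsum_inH (P a).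

Definition dsum_comulH (x : H) : (A * H) ⊗ (A * H) :=
  tmap dsum_inH dsum_inH (ΔH x) + tmap dsum_inA dsum_inH (ρ x)
  + tmap dsum_inH dsum_inA (γ x) + tmap dsum_inA dsum_inA (Q x).

Definition dsum_comul (u : A * H) : (A * H) ⊗ (A * H) :=
  dsum_comulA u.1 + dsum_comulH u.2.

Lemma dsum_comulA_linear : linear dsum_comulA.
Proof.
move=> k u v; rewrite /dsum_comulA !linearP !tmap_linear /=.
by rewrite addr4 -!scalerDr.
Qed.

Lemma dsum_comulH_linear : linear dsum_comulH.
Proof.
move=> k u v; rewrite /dsum_comulH !linearP !tmap_linear /=.
by rewrite addr4 -!scalerDr.
Qed.

Lemma dsum_comul_linear : linear dsum_comul.
Proof.
move=> k u v; rewrite /dsum_comul dsum_comulA_linear dsum_comulH_linear.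
by rewrite addrACA -scalerDr.
Qed.

HB.instance Definition _ := GRing.isLinear.Build K (A * H)%type
  ((A * H) ⊗ (A * H))%type *:%R dsum_comul dsum_comul_linear.

End CrossSystems.

(* Main.v *)
From HB Require Import structures.
Require Import Defs.
From mathcomp Require Import all_boot all_order all_algebra.

(** Write V for the direct sum A ⊕ H, with product m and coproduct D. Three
    multilinear maps measure how far V is from a left-symmetric bialgebra: the
    associator (uv)w - u(vw), the coassociator (D ⊗ id)D - (id ⊗ D)D, and the
    derivator

      d(u,v) = D(uv) - (u1 ⊗ u2 v + u v1 ⊗ v2 + v1 ⊗ u v2).

    V is a left-symmetric algebra when the associator is symmetric in its first two
    arguments, and a left-symmetric coalgebra when the coassociator is fixed by the
    flip of the first two legs. The two compatibility axioms also become symmetry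
    conditions, now on d alone: expanding the commutators, the axiom for D([u,v])
    says d(u,v) = d(v,u), and the axiom for (id - τ)D(uv) says that each d(u,v) is a
    symmetric tensor ([left_symmetric_bialgebraE]).

    Being multilinear, the three maps need only be known when each argument lies in A
    or in H, and their values only through their components along the decompositions
    of V, V ⊗ V and V ⊗ V ⊗ V. On such arguments each component of m and of D is a
    single structure map of the cross data, so that each component of a symmetry
    condition is, term by term, a single identity between these structure maps. For
    the associator the twelve resulting identities are those of the cocycle cross
    product system ([associator_sym]), and for the coassociator those of the cycle
    cross coproduct system ([coassociator_fixed]). For the derivator one finds the
    twenty identities of the double matched pair together with four more
    ([derivator_sym], [derivator_tau]): the A ⊗ A components of the two conditions at
    arguments in A, and the H ⊗ H components at arguments in H. These four are the
    compatibility axioms of cocycle braided bialgebras for A and for H, whence the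
    equivalence ([cross_bialgebraP]). *)

Set Implicit Arguments.
Unset Strict Implicit.
Unset Printing Implicit Defensive.

Import GRing.Theory.
Local Open Scope ring_scope.

(** * Identities in abelian groups, decided by reflection *)

(** Two occurrences of one summand can differ by the path along which the module
    structure on its type was found, so summands are compared up to conversion. The
    tensor operations are kept folded in these comparisons: unfolding them would
    reach sums over chosen representatives. *)
Create HintDb tensor_atoms.
#[local] Hint Opaque tens tensA tsum tmap tau tau12 : tensor_atoms.

Inductive zterm := ZVar of nat | ZZero | ZAdd of zterm & zterm | ZOpp of zterm.

Fixpoint zeval (V : zmodType) (env : seq V) (e : zterm) : V :=
  match e with
  | ZVar n => env`_n
  | ZZero => 0
  | ZAdd e1 e2 => zeval env e1 + zeval env e2
  | ZOpp e1 => - zeval env e1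
  end.

Fixpoint zcoef (e : zterm) (i : nat) : int :=
  match e with
  | ZVar n => (n == i)%:Z
  | ZZero => 0
  | ZAdd e1 e2 => zcoef e1 i + zcoef e2 i
  | ZOpp e1 => - zcoef e1 i
  end.

Lemma zevalE (V : zmodType) (env : seq V) e :
  zeval env e = \sum_(i < size env) env`_i *~ zcoef e i.
Proof.
elim: e => [n||e1 IH1 e2 IH2|e IH] /=.
- have [n_lt|n_ge] := ltnP n (size env).
    rewrite (bigD1 (Ordinal n_lt)) //= eqxx big1 ?addr0 // => i.
    by rewrite -val_eqE /= eq_sym => /negPf ->.
  rewrite nth_default // big1 // => i _; case: eqP => // ni.
  by move: (ltn_ord i); rewrite -ni ltnNge n_ge.
- by rewrite big1.
- by rewrite IH1 IH2 -big_split; apply: eq_bigr => i _; rewrite mulrzDr.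
- by rewrite IH -sumrN; apply: eq_bigr => i _; rewrite mulrNz.
Qed.

Lemma zeval_eq (V : zmodType) (env : seq V) e1 e2 :
    all (fun i => zcoef e1 i == zcoef e2 i) (iota 0 (size env)) ->
  zeval env e1 = zeval env e2.
Proof.
move=> /allP e12; rewrite !zevalE; apply: eq_bigr => i _.
by rewrite (eqP (e12 i _)) // mem_iota /= ltn_ord.
Qed.

Ltac zindex x env :=
  lazymatch env with
  | cons ?y ?env' =>
    match goal with
    | _ => let _ := match goal with
                    | _ => first [constr_eq x y | unify x y with tensor_atoms]
                    end in constr:(O)
    | _ => let n := zindex x env' in constr:(S n)
    end
  end.

Ltac zatoms t env :=
  lazymatch t with
  | @GRing.add _ ?a ?b => let env1 := zatoms a env in zatoms b env1
  | @GRing.opp _ ?a => zatoms a env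
  | @GRing.zero _ => env
  | _ => match goal with
         | _ => let _ := zindex t env in env
         | _ => constr:(cons t env)
         end
  end.

Ltac zquote t env :=
  lazymatch t with
  | @GRing.add _ ?a ?b =>
    let e1 := zquote a env in let e2 := zquote b env in constr:(ZAdd e1 e2)
  | @GRing.opp _ ?a => let e1 := zquote a env in constr:(ZOpp e1)
  | @GRing.zero _ => constr:(ZZero)
  | _ => let n := zindex t env in constr:(ZVar n)
  end.

Ltac abelian :=
  lazymatch goal with |- @eq ?T ?a ?b =>
    let env := zatoms a (@nil T) in
    let env := zatoms b env in
    let e1 := zquote a env in
    let e2 := zquote b env in
    apply: (@zeval_eq _ env e1 e2); vm_compute; reflexivity
  end.

Lemma eq_subr (V : zmodType) (a b c d : V) : a = b -> c - d = a - b -> c = d.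
Proof. by move=> ->; rewrite subrr => /eqP; rewrite subr_eq0 => /eqP. Qed.

Ltac abelian_from ab := apply: (eq_subr ab); abelian.

(** * Linear maps out of tensor products *)

Section TensorMaps.
Variable K : fieldType.
Implicit Types U V W X : lmodType K.

(** As [tsum f t] is a finite sum over a representative of [t], the identities in which
    [t] stays the same hold for arbitrary functions; bilinearity matters only when the
    tensor changes. *)
Lemma eq_tsum U V W (f g : U -> V -> W) t :
  (forall u v, f u v = g u v) -> tsum f t = tsum g t.
Proof. by move=> fg; apply: eq_bigr => p _; apply: fg. Qed.

Lemma tsumD U V W (f g : U -> V -> W) t :
  tsum (fun u v => f u v + g u v) t = tsum f t + tsum g t.
Proof. exact: big_split. Qed.

Lemma tsumB U V W (f g : U -> V -> W) t :
  tsum (fun u v => f u v - g u v) t = tsum f t - tsum g t.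
Proof. exact: sumrB. Qed.

Lemma linear_tsum U V W X (h : {linear W -> X}) (f : U -> V -> W) t :
  h (tsum f t) = tsum (fun u v => h (f u v)) t.
Proof. exact: linear_sum. Qed.

Lemma tsum_tens_id U V (t : U ⊗ V) : \Sw[u, v <- t] u ⊗ v = t.
Proof. exact/esym/tensor_sum. Qed.

Lemma tsum_commutatorl U V (m : {bilinear V -> V -> V}) (t : U ⊗ V) w :
  \Sw[u, v <- t] u ⊗ commutator m v w =
  \Sw[u, v <- t] u ⊗ m v w - \Sw[u, v <- t] u ⊗ m w v.
Proof. by rewrite -tsumB; apply: eq_tsum => u v; rewrite -linearBr. Qed.

Lemma tsum_commutatorr U V (m : {bilinear V -> V -> V}) (t : U ⊗ V) w :
  \Sw[u, v <- t] u ⊗ commutator m w v =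
  \Sw[u, v <- t] u ⊗ m w v - \Sw[u, v <- t] u ⊗ m v w.
Proof. by rewrite -tsumB; apply: eq_tsum => u v; rewrite -linearBr. Qed.

HB.instance Definition _ U V U' V' (f : {linear U -> U'}) (g : {linear V -> V'}) :=
  GRing.isLinear.Build K (U ⊗ V)%type (U' ⊗ V')%type *:%R (tmap f g)
    (tmap_linear f g).

Lemma bilinear_tensl U V W (f : {linear U -> W}) :
  bilinear_for *:%R *:%R (fun (u : U) (v : V) => f u ⊗ v).
Proof.
by split=> [v | u] k x y /=; [rewrite linearP linearPl | rewrite linearPr].
Qed.

Lemma bilinear_tensr U V W (f : {linear V -> W}) :
  bilinear_for *:%R *:%R (fun (u : U) (v : V) => u ⊗ f v).
Proof.
by split=> [v | u] k x y /=; [rewrite linearPl | rewrite linearP linearPr].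
Qed.

Lemma bilinear_swap U V W (f : U -> V -> W) :
  bilinear_for *:%R *:%R f -> bilinear_for *:%R *:%R (fun v u => f u v).
Proof. by case=> fl fr; split. Qed.

Lemma bilinear_comp U V U' V' W (c : U' -> V' -> W) (f : {linear U -> U'})
    (g : {linear V -> V'}) :
  bilinear_for *:%R *:%R c -> bilinear_for *:%R *:%R (fun u v => c (f u) (g v)).
Proof.
by move=> [cl cr]; split=> [v | u] k x y; rewrite linearP; [apply: cl | apply: cr].
Qed.

Lemma tmap_tens U V U' V' (f : {linear U -> U'}) (g : {linear V -> V'}) u v :
  tmap f g (u ⊗ v) = f u ⊗ g v.
Proof.
apply: tsum_tens.
by split=> [y | x] k x1 x2 /=; rewrite linearP ?linearPl ?linearPr.
Qed.

(** Substitution in Sweedler notation. The left side evaluates [c] on a representative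
    of the image tensor that is unrelated to the one of [t]; only bilinearity of [c]
    makes the choice irrelevant. *)
Lemma tsum_tmap U V U' V' W (c : U' -> V' -> W) (f : U -> U') (g : V -> V') t :
    bilinear_for *:%R *:%R c ->
  tsum c (tmap f g t) = \Sw[u, v <- t] c (f u) (g v).
Proof.
move=> c_bil.
pose F : {linear (U' ⊗ V')%type -> W} := HB.pack (tsum c)
  (GRing.isLinear.Build K _ _ _ (tsum c) (tsum_linear c_bil)).
rewrite -[LHS]/(F _) linear_tsum; apply: eq_tsum => u v.
exact: tsum_tens.
Qed.

Lemma bilinear_tsumD U V W (f : U -> V -> W) t t' :
  bilinear_for *:%R *:%R f -> tsum f (t + t') = tsum f t + tsum f t'.
Proof. by move=> f_bil; have := tsum_linear f_bil 1 t t'; rewrite !scale1r. Qed.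

Lemma tmapD U V U' V' (f : {linear U -> U'}) (g : {linear V -> V'}) :
  {morph tmap f g : s t / s + t}.
Proof. exact: linearD. Qed.

Lemma tmapB U V U' V' (f : {linear U -> U'}) (g : {linear V -> V'}) :
  {morph tmap f g : s t / s - t}.
Proof. exact: linearB. Qed.

Lemma tmap0l U V U' V' (f : {linear U -> U'}) (g : {linear V -> V'}) t :
  (forall u, f u = 0) -> tmap f g t = 0.
Proof. by move=> f0; apply: big1 => p _; rewrite f0 linear0l. Qed.

Lemma tmap0r U V U' V' (f : {linear U -> U'}) (g : {linear V -> V'}) t :
  (forall v, g v = 0) -> tmap f g t = 0.
Proof. by move=> g0; apply: big1 => p _; rewrite g0 linear0r. Qed.

Lemma tmap_id U V (f : {linear U -> U}) (g : {linear V -> V}) t :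
  f =1 id -> g =1 id -> tmap f g t = t.
Proof.
by move=> f_id g_id; rewrite -[RHS]tsum_tens_id; apply: eq_tsum => u v; rewrite f_id g_id.
Qed.

Lemma tau_linear U V : linear (@tau K U V).
Proof. by apply: tsum_linear; apply: bilinear_swap; apply: tens_is_bilinear. Qed.
HB.instance Definition _ U V := GRing.isLinear.Build K (U ⊗ V)%type (V ⊗ U)%type
  *:%R (@tau K U V) (@tau_linear U V).

Lemma tauD U V : {morph @tau K U V : s t / s + t}.
Proof. exact: linearD. Qed.

Lemma tauB U V : {morph @tau K U V : s t / s - t}.
Proof. exact: linearB. Qed.

Lemma tau12_linear U V W : linear (@tau12 K U V W).
Proof. exact: tsum_linear (bilinear_tensl _ (@tau K U V)). Qed.
HB.instance Definition _ U V W := GRing.isLinear.Build K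
  (U ⊗ V ⊗ W)%type (V ⊗ U ⊗ W)%type *:%R (@tau12 K U V W) (@tau12_linear U V W).

Lemma tens_linear U V (u : U) : linear (@tens K U V u).
Proof. by move=> k v v'; rewrite linearPr. Qed.
HB.instance Definition _ U V u := GRing.isLinear.Build K V (U ⊗ V)%type *:%R
  (@tens K U V u) (@tens_linear U V u).

Lemma tensA_is_bilinear U V W : bilinear_for *:%R *:%R (@tensA K U V W).
Proof.
split=> [t | u]; last exact: tsum_linear (bilinear_tensl _ (tens u)).
move=> k u u' /=; rewrite /tensA scaler_sumr -big_split; apply: eq_bigr => p _.
by rewrite linearPl linearPl.
Qed.
HB.instance Definition _ U V W := bilinear_isBilinear.Build K U (V ⊗ W)%type
  (U ⊗ V ⊗ W)%type *:%R *:%R (@tensA K U V W) (@tensA_is_bilinear U V W).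

Lemma bilinear_tensAr U V W X (f : {linear V -> (W ⊗ X)%type}) :
  bilinear_for *:%R *:%R (fun (u : U) (v : V) => u ⊗: f v).
Proof.
by split=> [v | u] k x y /=; [rewrite linearPl | rewrite linearP linearPr].
Qed.

Lemma tauK U V : cancel (@tau K U V) (@tau K V U).
Proof.
move=> t; rewrite {2}/tau linear_tsum -[RHS]tsum_tens_id; apply: eq_tsum => u v.
by apply: tsum_tens; apply: bilinear_swap; apply: tens_is_bilinear.
Qed.

Lemma tau12D U V W : {morph @tau12 K U V W : s t / s + t}.
Proof. exact: linearD. Qed.

Lemma tau12B U V W : {morph @tau12 K U V W : s t / s - t}.
Proof. exact: linearB. Qed.

Lemma tau12K U V W : cancel (@tau12 K U V W) (@tau12 K V U W).
Proof.
move=> t; rewrite {2}/tau12 linear_tsum -[RHS]tsum_tens_id; apply: eq_tsum => s w.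
rewrite [LHS]tsum_tens ?tauK //; exact: (bilinear_tensl _ (@tau K _ _)).
Qed.

Lemma tau_eqC U V (s : U ⊗ V) (t : V ⊗ U) : s = tau t -> t = tau s.
Proof. by move=> ->; rewrite tauK. Qed.

Lemma tau12_eqC U V W (s : U ⊗ V ⊗ W) (t : V ⊗ U ⊗ W) : s = tau12 t -> t = tau12 s.
Proof. by move=> ->; rewrite tau12K. Qed.

Lemma tmap_tau U V U' V' (f : {linear U -> U'}) (g : {linear V -> V'}) t :
  tmap g f (tau t) = tau (tmap f g t).
Proof.
rewrite [RHS]tsum_tmap; last by apply: bilinear_swap; apply: tens_is_bilinear.
by rewrite linear_tsum /=; apply: eq_tsum => u v; apply: tmap_tens.
Qed.

Lemma tmap_tau12 U V W U' V' W' (f : {linear U -> U'}) (g : {linear V -> V'})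
    (h : {linear W -> W'}) t :
  tmap (tmap g f) h (tau12 t) = tau12 (tmap (tmap f g) h t).
Proof.
rewrite [RHS]tsum_tmap; last exact: (bilinear_tensl _ (@tau K _ _)).
by rewrite linear_tsum /=; apply: eq_tsum => u v; rewrite tmap_tens /= tmap_tau.
Qed.

Lemma tmap_tensA U V W U' V' W' (f : {linear U -> U'}) (g : {linear V -> V'})
    (h : {linear W -> W'}) u t :
  tmap (tmap f g) h (u ⊗: t) = f u ⊗: tmap g h t.
Proof.
rewrite [RHS]tsum_tmap; last exact: (bilinear_tensl _ (tens (f u))).
by rewrite linear_tsum; apply: eq_tsum => v w; rewrite [LHS]tmap_tens /= tmap_tens.
Qed.

Lemma eq_tmap U V U' V' (f1 f2 : U -> U') (g1 g2 : V -> V') t :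
  f1 =1 f2 -> g1 =1 g2 -> tmap f1 g1 t = tmap f2 g2 t.
Proof. by move=> ef eg; apply: eq_tsum => u v; rewrite ef eg. Qed.

Lemma tmap_comp U1 U2 U3 V1 V2 V3 (f : {linear U2 -> U3}) (g : {linear V2 -> V3})
    (f' : {linear U1 -> U2}) (g' : {linear V1 -> V2}) t :
  tmap f g (tmap f' g' t) = tmap (f \o f') (g \o g') t.
Proof. by rewrite {2}/tmap linear_tsum; apply: eq_tsum => u v; apply: tmap_tens. Qed.

(** A decomposition of U as a direct sum induces one of U ⊗ X and of X ⊗ U, so these
    lemmas can be iterated to decompose longer tensor products. *)
Section Split.
Variables (U U1 U2 : lmodType K) (i1 : {linear U1 -> U}) (i2 : {linear U2 -> U}).
Variables (p1 : {linear U -> U1}) (p2 : {linear U -> U2}).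
Hypothesis U_split : forall u, u = i1 (p1 u) + i2 (p2 u).

Lemma tmap_splitl X (t : U ⊗ X) :
  t = tmap i1 idfun (tmap p1 idfun t) + tmap i2 idfun (tmap p2 idfun t).
Proof.
rewrite !tmap_comp -tsumD -[LHS]tsum_tens_id; apply: eq_tsum => u x /=.
by rewrite -linearDl -U_split.
Qed.

Lemma tmap_splitr X (t : X ⊗ U) :
  t = tmap idfun i1 (tmap idfun p1 t) + tmap idfun i2 (tmap idfun p2 t).
Proof.
rewrite !tmap_comp -tsumD -[LHS]tsum_tens_id; apply: eq_tsum => x u /=.
by rewrite -linearDr -U_split.
Qed.

Lemma tensor_split_extl X (t t' : U ⊗ X) :
  tmap p1 idfun t = tmap p1 idfun t' -> tmap p2 idfun t = tmap p2 idfun t' -> t = t'.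
Proof. by move=> e1 e2; rewrite [t]tmap_splitl [t']tmap_splitl e1 e2. Qed.

Lemma tensor_split_extr X (t t' : X ⊗ U) :
  tmap idfun p1 t = tmap idfun p1 t' -> tmap idfun p2 t = tmap idfun p2 t' -> t = t'.
Proof. by move=> e1 e2; rewrite [t]tmap_splitr [t']tmap_splitr e1 e2. Qed.
End Split.

End TensorMaps.

(** * Components of tensors over a direct sum *)

Section DirectSum.
Variables (K : fieldType) (A H : lmodType K).
Implicit Types X Y W : lmodType K.
Local Notation V := (A * H)%type.
Local Notation inA := (@dsum_inA K A H).
Local Notation inH := (@dsum_inH K A H).

Lemma dsum_split (u : V) : u = inA u.1 + inH u.2.
Proof. by case: u => a x; congr pair; rewrite /= ?addr0 ?add0r. Qed.

(** Only the leg over the direct sum is decomposed here; the other one stays arbitrary,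
    so that a single statement serves both choices of its component. *)
Lemma tsum_dsuml X Y W (c : V -> Y -> W) (g : {linear X -> Y}) (t : V ⊗ X) :
    bilinear_for *:%R *:%R c ->
  \Sw[u, v <- t] c u (g v) =
  \Sw[a, w <- tmap fst g t] c (inA a) w + \Sw[x, w <- tmap snd g t] c (inH x) w.
Proof.
move=> [cl cr]; rewrite !tsum_tmap.
- rewrite -tsumD; apply: eq_tsum => u v.
  by have /= := cl (g v) 1 (inA u.1) (inH u.2); rewrite !scale1r -dsum_split.
- exact: (bilinear_comp inH idfun (cl, cr)).
- exact: (bilinear_comp inA idfun (cl, cr)).
Qed.

Lemma tsum_dsumr X Y W (c : Y -> V -> W) (f : {linear X -> Y}) (t : X ⊗ V) :
    bilinear_for *:%R *:%R c ->
  \Sw[u, v <- t] c (f u) v =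
  \Sw[w, a <- tmap f fst t] c w (inA a) + \Sw[w, x <- tmap f snd t] c w (inH x).
Proof.
move=> [cl cr]; rewrite !tsum_tmap.
- rewrite -tsumD; apply: eq_tsum => u v.
  by have /= := cr (f u) 1 (inA v.1) (inH v.2); rewrite !scale1r -dsum_split.
- exact: (bilinear_comp idfun inH (cl, cr)).
- exact: (bilinear_comp idfun inA (cl, cr)).
Qed.

Lemma tensor2_dsum_ext (t t' : V ⊗ V) :
    tmap fst fst t = tmap fst fst t' -> tmap snd fst t = tmap snd fst t' ->
    tmap fst snd t = tmap fst snd t' -> tmap snd snd t = tmap snd snd t' ->
  t = t'.
Proof.
move=> eAA eHA eAH eHH; apply: (tensor_split_extl dsum_split);
  by apply: (tensor_split_extr dsum_split); rewrite !tmap_comp.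
Qed.

Lemma tensor3_dsum_ext (t t' : V ⊗ V ⊗ V) :
    tmap (tmap fst fst) fst t = tmap (tmap fst fst) fst t' ->
    tmap (tmap snd fst) fst t = tmap (tmap snd fst) fst t' ->
    tmap (tmap fst snd) fst t = tmap (tmap fst snd) fst t' ->
    tmap (tmap snd snd) fst t = tmap (tmap snd snd) fst t' ->
    tmap (tmap fst fst) snd t = tmap (tmap fst fst) snd t' ->
    tmap (tmap snd fst) snd t = tmap (tmap snd fst) snd t' ->
    tmap (tmap fst snd) snd t = tmap (tmap fst snd) snd t' ->
    tmap (tmap snd snd) snd t = tmap (tmap snd snd) snd t' ->
  t = t'.
Proof.
have merge (X Y Z : lmodType K) (f : {linear V -> X}) (g : {linear V -> Y})
    (h : {linear V -> Z}) s : tmap (tmap idfun g) idfun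
    (tmap (tmap f idfun) idfun (tmap idfun h s)) = tmap (tmap f g) h s.
  by rewrite !tmap_comp; apply: eq_tmap => // r; rewrite /= tmap_comp.
(* Split the third leg, then the first, then the second. *)
move=> *; apply: (tensor_split_extr dsum_split);
  apply: (tensor_split_extl (tmap_splitl dsum_split (X := _)));
  apply: (tensor_split_extl (tmap_splitr dsum_split (X := _)));
  by rewrite /= !merge.
Qed.

(** The flip preserves the two diagonal components and exchanges the two mixed ones, so
    a single mixed equation is enough. *)
Lemma tau_dsum_fixed (t : V ⊗ V) :
    tmap fst fst t = tau (tmap fst fst t) -> tmap snd snd t = tau (tmap snd snd t) ->
    tmap snd fst t = tau (tmap fst snd t) ->
  tau t = t.
Proof.
by move=> eAA eHH eHA; apply: tensor2_dsum_ext; rewrite tmap_tau // eHA tauK.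
Qed.

Lemma tau12_dsum_fixed (t : V ⊗ V ⊗ V) :
    tau12 (tmap (tmap fst fst) fst t) = tmap (tmap fst fst) fst t ->
    tau12 (tmap (tmap snd snd) fst t) = tmap (tmap snd snd) fst t ->
    tmap (tmap snd fst) fst t = tau12 (tmap (tmap fst snd) fst t) ->
    tau12 (tmap (tmap fst fst) snd t) = tmap (tmap fst fst) snd t ->
    tau12 (tmap (tmap snd snd) snd t) = tmap (tmap snd snd) snd t ->
    tmap (tmap snd fst) snd t = tau12 (tmap (tmap fst snd) snd t) ->
  tau12 t = t.
Proof.
move=> eAAA eHHA eHAA eAAH eHHH eHAH.
by apply: tensor3_dsum_ext; rewrite tmap_tau12 // (eHAA, eHAH) tau12K.
Qed.

(** Symmetry at (x, b) is the same equation as symmetry at (b, x): three of the four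
    types of arguments remain. *)
Lemma dsum_biadditive_sym (W : zmodType) (F : V -> V -> W) :
    (forall u u' v, F (u + u') v = F u v + F u' v) ->
    (forall u v v', F u (v + v') = F u v + F u v') ->
    (forall a b, F (inA a) (inA b) = F (inA b) (inA a)) ->
    (forall x y, F (inH x) (inH y) = F (inH y) (inH x)) ->
    (forall x b, F (inH x) (inA b) = F (inA b) (inH x)) ->
  forall u v, F u v = F v u.
Proof.
move=> FDl FDr FAA FHH FHA u v.
rewrite [u]dsum_split [v]dsum_split !FDl !FDr (FAA v.1) (FHH v.2) !FHA; abelian.
Qed.

End DirectSum.

(** * The three defects of a left-symmetric bialgebra *)

Section Defects.
Variables (K : fieldType) (V : lmodType K).
Implicit Types X Y : lmodType K.
Variables (m : {bilinear V -> V -> V}) (D : {linear V -> (V ⊗ V)%type}).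

Definition associator (u v w : V) : V := m (m u v) w - m u (m v w).

Definition coassociator (u : V) : V ⊗ V ⊗ V :=
  \Sw[u1, u2 <- D u] D u1 ⊗ u2 - \Sw[u1, u2 <- D u] u1 ⊗: D u2.

(** The Leibniz defect of D: V acts on V ⊗ V on the left through both legs, and on the
    right through the second leg alone. *)
Definition derivator (u v : V) : V ⊗ V :=
  D (m u v) - (\Sw[u1, u2 <- D u] u1 ⊗ m u2 v
    + \Sw[v1, v2 <- D v] m u v1 ⊗ v2
    + \Sw[v1, v2 <- D v] v1 ⊗ m u v2).

Lemma tmap_coassociator X Y (f : {linear (V ⊗ V)%type -> X}) (g : {linear V -> Y}) u :
  tmap f g (coassociator u) = tmap f g (\Sw[u1, u2 <- D u] D u1 ⊗ u2)
    - tmap f g (\Sw[u1, u2 <- D u] u1 ⊗: D u2).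
Proof. exact: tmapB. Qed.

Lemma tmap_derivator X Y (f : {linear V -> X}) (g : {linear V -> Y}) u v :
  tmap f g (derivator u v) = tmap f g (D (m u v))
    - (tmap f g (\Sw[u1, u2 <- D u] u1 ⊗ m u2 v)
      + tmap f g (\Sw[v1, v2 <- D v] m u v1 ⊗ v2)
      + tmap f g (\Sw[v1, v2 <- D v] v1 ⊗ m u v2)).
Proof. by rewrite /derivator tmapB !tmapD. Qed.

(** On the right of the bracket axiom, expanding the commutators gives six terms: the
    three correction terms of d(u,v) minus the three of d(v,u). In the other axiom,
    id - τ is applied to d(u,v) itself. *)
Lemma left_symmetric_bialgebraE :
  left_symmetric_bialgebra m D <->
  [/\ forall u v w, associator u v w = associator v u w,
      forall u, tau12 (coassociator u) = coassociator u,
      forall u v, derivator u v = derivator v u &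
      forall u v, tau (derivator u v) = derivator u v].
Proof.
have bracketE u v : derivator u v - derivator v u = D (commutator m u v)
  - (\Sw[b1, b2 <- D v] m u b1 ⊗ b2
    + \Sw[b1, b2 <- D v] b1 ⊗ commutator m u b2
    - \Sw[a1, a2 <- D u] m v a1 ⊗ a2
    - \Sw[a1, a2 <- D u] a1 ⊗ commutator m v a2).
  have -> : D (commutator m u v) = D (m u v) - D (m v u) by exact: linearB.
  by rewrite !tsum_commutatorr /derivator; abelian.
have mulE u v : derivator u v - tau (derivator u v) = Defs.skew (D (m u v))
  - Defs.skew (\Sw[u1, u2 <- D u] u1 ⊗ m u2 v
    + \Sw[v1, v2 <- D v] m u v1 ⊗ v2
    + \Sw[v1, v2 <- D v] v1 ⊗ m u v2).
  by rewrite /Defs.skew /derivator tauB; abelian.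
split=> [[alg coalg bracket mul] | [alg coalg bracket mul]]; split=> //.
- by move=> u v; apply/eqP; rewrite -subr_eq0 bracketE bracket subrr.
- by move=> u v; apply/esym/eqP; rewrite -subr_eq0 mulE mul subrr.
- by move=> u v; apply/eqP; rewrite -subr_eq0 -bracketE bracket subrr.
- by move=> u v; apply/eqP; rewrite -subr_eq0 -mulE mul subrr.
Qed.

Lemma associatorD1 u u' v w :
  associator (u + u') v w = associator u v w + associator u' v w.
Proof. by rewrite /associator !(linearDl, linearDr); abelian. Qed.

Lemma associatorD2 u v v' w :
  associator u (v + v') w = associator u v w + associator u v' w.
Proof. by rewrite /associator !(linearDl, linearDr); abelian. Qed.

Lemma associatorD3 u v w w' :
  associator u v (w + w') = associator u v w + associator u v w'.
Proof. by rewrite /associator !(linearDl, linearDr); abelian. Qed.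

Lemma coassociatorD u u' : coassociator (u + u') = coassociator u + coassociator u'.
Proof.
rewrite /coassociator linearD (bilinear_tsumD _ _ (bilinear_tensl _ D)).
by rewrite (bilinear_tsumD _ _ (bilinear_tensAr _ D)); abelian.
Qed.

Lemma derivatorDl u u' v : derivator (u + u') v = derivator u v + derivator u' v.
Proof.
rewrite /derivator linearDl !(linearD D).
rewrite (bilinear_tsumD _ _ (bilinear_tensr _ (applyr m v))).
have -> : \Sw[v1, v2 <- D v] m (u + u') v1 ⊗ v2
    = \Sw[v1, v2 <- D v] m u v1 ⊗ v2 + \Sw[v1, v2 <- D v] m u' v1 ⊗ v2.
  by rewrite -tsumD; apply: eq_tsum => v1 v2; rewrite !linearDl.
have -> : \Sw[v1, v2 <- D v] v1 ⊗ m (u + u') v2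
    = \Sw[v1, v2 <- D v] v1 ⊗ m u v2 + \Sw[v1, v2 <- D v] v1 ⊗ m u' v2.
  by rewrite -tsumD; apply: eq_tsum => v1 v2; rewrite linearDl linearDr.
abelian.
Qed.

Lemma derivatorDr u v v' : derivator u (v + v') = derivator u v + derivator u v'.
Proof.
rewrite /derivator linearDr !(linearD D) (bilinear_tsumD _ _ (bilinear_tensl _ (m u))).
rewrite (bilinear_tsumD _ _ (bilinear_tensr _ (m u))).
have -> : \Sw[u1, u2 <- D u] u1 ⊗ m u2 (v + v')
    = \Sw[u1, u2 <- D u] u1 ⊗ m u2 v + \Sw[u1, u2 <- D u] u1 ⊗ m u2 v'.
  by rewrite -tsumD; apply: eq_tsum => u1 u2; rewrite !linearDr.
abelian.
Qed.

End Defects.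

(** * Components of products and coproducts of tensors *)

Section DirectSumComponents.
Variables (K : fieldType) (A H : lmodType K).
Implicit Types W X Y Z : lmodType K.
Local Notation V := (A * H)%type.
Local Notation inA := (@dsum_inA K A H).
Local Notation inH := (@dsum_inH K A H).

(** A component of a tensor with F applied to one leg is a sum over the two summands of
    V from which that leg may come. The restrictions FA and FH of the relevant
    component of F enter as data, in the form in which they should appear. *)
Lemma tmap_dsuml W X Y (F : V -> W) (f : {linear W -> X}) (g : {linear V -> Y})
    (FA : A -> X) (FH : H -> X) (t : V ⊗ V) :
    linear F ->
    (forall a, f (F (inA a)) = FA a) -> (forall x, f (F (inH x)) = FH x) ->
  tmap f g (\Sw[u, v <- t] F u ⊗ v) =
  \Sw[a, w <- tmap fst g t] FA a ⊗ w + \Sw[x, w <- tmap snd g t] FH x ⊗ w.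
Proof.
move=> F_lin FAE FHE.
pose fF : {linear V -> X} := HB.pack (f \o F) (GRing.isLinear.Build K V X *:%R
  (f \o F) (fun k u v => etrans (congr1 f (F_lin k u v)) (linearP f k _ _))).
transitivity (\Sw[u, v <- t] fF u ⊗ g v).
  by rewrite linear_tsum; apply: eq_tsum => u v; apply: tmap_tens.
rewrite (tsum_dsuml _ _ (bilinear_tensl _ fF)).
by congr (_ + _); apply: eq_tsum => ? w; congr (_ ⊗ w); [apply: FAE | apply: FHE].
Qed.

Lemma tmap_dsumr W X Y (F : V -> W) (f : {linear V -> X}) (g : {linear W -> Y})
    (FA : A -> Y) (FH : H -> Y) (t : V ⊗ V) :
    linear F ->
    (forall a, g (F (inA a)) = FA a) -> (forall x, g (F (inH x)) = FH x) ->
  tmap f g (\Sw[u, v <- t] u ⊗ F v) =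
  \Sw[w, a <- tmap f fst t] w ⊗ FA a + \Sw[w, x <- tmap f snd t] w ⊗ FH x.
Proof.
move=> F_lin FAE FHE.
pose gF : {linear V -> Y} := HB.pack (g \o F) (GRing.isLinear.Build K V Y *:%R
  (g \o F) (fun k u v => etrans (congr1 g (F_lin k u v)) (linearP g k _ _))).
transitivity (\Sw[u, v <- t] f u ⊗ gF v).
  by rewrite linear_tsum; apply: eq_tsum => u v; apply: tmap_tens.
rewrite (tsum_dsumr _ _ (bilinear_tensr _ gF)).
by congr (_ + _); apply: eq_tsum => w ?; congr (w ⊗ _); [apply: FAE | apply: FHE].
Qed.

Lemma tmap_dsum_tensAr X Y Z (D : {linear V -> (V ⊗ V)%type}) (f : {linear V -> X})
    (g : {linear V -> Y}) (h : {linear V -> Z}) FA FH (t : V ⊗ V) :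
    (forall a, tmap g h (D (inA a)) = FA a) ->
    (forall x, tmap g h (D (inH x)) = FH x) ->
  tmap (tmap f g) h (\Sw[u, v <- t] u ⊗: D v) =
  \Sw[w, a <- tmap f fst t] w ⊗: FA a + \Sw[w, x <- tmap f snd t] w ⊗: FH x.
Proof.
move=> FAE FHE; transitivity (\Sw[u, v <- t] f u ⊗: tmap g h (D v)).
  by rewrite linear_tsum; apply: eq_tsum => u v; apply: tmap_tensA.
rewrite (tsum_dsumr _ _ (bilinear_tensAr _ (tmap g h \o D))).
by congr (_ + _); apply: eq_tsum => w ?; congr (w ⊗: _); [apply: FAE | apply: FHE].
Qed.

End DirectSumComponents.

(** * Structure maps as components *)

Section CrossBialgebra.
Variables (K : fieldType) (A H : lmodType K) (E : cross_data A H).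
Local Notation V := (A * H)%type.
Local Notation inA := (@dsum_inA K A H).
Local Notation inH := (@dsum_inH K A H).
Local Notation "a ∙ b" := (cd_mulA E a b) (at level 35, no associativity).
Local Notation "x ∗ y" := (cd_mulH E x y) (at level 35, no associativity).
Local Notation "x ⇀ a" := (cd_ract E x a) (at level 35, no associativity).
Local Notation "a ↼ x" := (cd_lact E a x) (at level 35, no associativity).
Local Notation "a ▷ x" := (cd_rtri E a x) (at level 35, no associativity).
Local Notation "x ◁ a" := (cd_ltri E x a) (at level 35, no associativity).
Local Notation ΔA := (cd_comulA E).
Local Notation ΔH := (cd_comulH E).
Local Notation σ := (cd_sigma E).
Local Notation θ := (cd_theta E).
Local Notation φ := (cd_phi E).
Local Notation ψ := (cd_psi E).
Local Notation ρ := (cd_rho E).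
Local Notation γ := (cd_gamma E).
Local Notation P := (cd_P E).
Local Notation Q := (cd_Q E).

Implicit Types (X Y : lmodType K) (a b : A) (x y : H).

(** The product and the coproduct of V are abstract here and known by their values
    only: this keeps rewriting with their components from unfolding them. *)
Variables (m : {bilinear V -> V -> V}) (D : {linear V -> (V ⊗ V)%type}).
Hypotheses (mE : forall u v, m u v = dsum_mul E u v).
Hypotheses (DE : forall u, D u = dsum_comul E u).

Lemma mul_pairA a x b : m (a, x) (inA b) = (a ∙ b + x ⇀ b, x ◁ b + θ a b).
Proof. by rewrite mE; congr pair; rewrite /= !linear0r !addr0 ?add0r. Qed.

Lemma mul_pairH a x y : m (a, x) (inH y) = (a ↼ y + σ x y, x ∗ y + a ▷ y).
Proof. by rewrite mE; congr pair; rewrite /= !linear0r ?addr0 ?add0r. Qed.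

Lemma mul_Apair a b y : m (inA a) (b, y) = (a ∙ b + a ↼ y, a ▷ y + θ a b).
Proof. by rewrite mE; congr pair; rewrite /= !linear0l ?addr0 ?add0r. Qed.

Lemma mul_Hpair x b y : m (inH x) (b, y) = (x ⇀ b + σ x y, x ∗ y + x ◁ b).
Proof. by rewrite mE; congr pair; rewrite /= !linear0l ?addr0 ?add0r. Qed.

Lemma mul_AA a b : m (inA a) (inA b) = (a ∙ b, θ a b).
Proof. by rewrite mul_pairA !linear0l addr0 add0r. Qed.

Lemma mul_AH a y : m (inA a) (inH y) = (a ↼ y, a ▷ y).
Proof. by rewrite mul_pairH !linear0l addr0 add0r. Qed.

Lemma mul_HA x b : m (inH x) (inA b) = (x ⇀ b, x ◁ b).
Proof. by rewrite mul_pairA !linear0l addr0 add0r. Qed.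

Lemma mul_HH x y : m (inH x) (inH y) = (σ x y, x ∗ y).
Proof. by rewrite mul_pairH !linear0l addr0 add0r. Qed.

Lemma tmap_comul X Y (f : {linear V -> X}) (g : {linear V -> Y}) a x :
  tmap f g (D (a, x)) =
    tmap (f \o inA) (g \o inA) (ΔA a + Q x) + tmap (f \o inH) (g \o inA) (φ a + γ x)
  + tmap (f \o inA) (g \o inH) (ψ a + ρ x) + tmap (f \o inH) (g \o inH) (P a + ΔH x).
Proof.
rewrite DE /dsum_comul /dsum_comulA /dsum_comulH !tmapD !tmap_comp /=.
abelian.
Qed.

Lemma comul_AA a x : tmap fst fst (D (a, x)) = ΔA a + Q x.
Proof. by rewrite tmap_comul tmap_id // tmap0l // tmap0r // tmap0l // !addr0. Qed.

Lemma comul_HA a x : tmap snd fst (D (a, x)) = φ a + γ x.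
Proof. by rewrite tmap_comul tmap0l // tmap_id // tmap0l // tmap0r // !addr0 add0r. Qed.

Lemma comul_AH a x : tmap fst snd (D (a, x)) = ψ a + ρ x.
Proof. by rewrite tmap_comul tmap0r // tmap0l // tmap_id // tmap0l // !addr0 !add0r. Qed.

Lemma comul_HH a x : tmap snd snd (D (a, x)) = P a + ΔH x.
Proof. by rewrite tmap_comul tmap0l // tmap0r // tmap0l // tmap_id // !add0r. Qed.

Lemma comulA_AA a : tmap fst fst (D (inA a)) = ΔA a.
Proof. by rewrite comul_AA linear0 addr0. Qed.

Lemma comulA_HA a : tmap snd fst (D (inA a)) = φ a.
Proof. by rewrite comul_HA linear0 addr0. Qed.

Lemma comulA_AH a : tmap fst snd (D (inA a)) = ψ a.
Proof. by rewrite comul_AH linear0 addr0. Qed.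

Lemma comulA_HH a : tmap snd snd (D (inA a)) = P a.
Proof. by rewrite comul_HH linear0 addr0. Qed.

Lemma comulH_AA x : tmap fst fst (D (inH x)) = Q x.
Proof. by rewrite comul_AA linear0 add0r. Qed.

Lemma comulH_HA x : tmap snd fst (D (inH x)) = γ x.
Proof. by rewrite comul_HA linear0 add0r. Qed.

Lemma comulH_AH x : tmap fst snd (D (inH x)) = ρ x.
Proof. by rewrite comul_AH linear0 add0r. Qed.

Lemma comulH_HH x : tmap snd snd (D (inH x)) = ΔH x.
Proof. by rewrite comul_HH linear0 add0r. Qed.

Definition comul_pureE := (comulA_AA, comulA_HA, comulA_AH, comulA_HH,
  comulH_AA, comulH_HA, comulH_AH, comulH_HH).
Definition comul_pairE := (comul_AA, comul_HA, comul_AH, comul_HH).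
Definition mul_pureE := (mul_AA, mul_AH, mul_HA, mul_HH).

Let m_linear u : linear (m u).
Proof. by move=> k v w; rewrite linearPr. Qed.

Let m_linearr v : linear (m^~ v).
Proof. by move=> k u w; rewrite linearPl. Qed.

(** In the next two sections, [g], [f] and [h] choose the component of the leg that is
    not acted upon. *)
Section Act.
Variables (X : lmodType K) (t : V ⊗ V).

Lemma lmul_inA_left (g : {linear V -> X}) a :
  (tmap fst g (\Sw[u, v <- t] m (inA a) u ⊗ v) =
    \Sw[b, w <- tmap fst g t] (a ∙ b) ⊗ w + \Sw[y, w <- tmap snd g t] (a ↼ y) ⊗ w)
  * (tmap snd g (\Sw[u, v <- t] m (inA a) u ⊗ v) =
    \Sw[b, w <- tmap fst g t] θ a b ⊗ w + \Sw[y, w <- tmap snd g t] (a ▷ y) ⊗ w).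
Proof. by split; apply: tmap_dsuml => // ?; rewrite mul_pureE. Qed.

Lemma lmul_inH_left (g : {linear V -> X}) x :
  (tmap fst g (\Sw[u, v <- t] m (inH x) u ⊗ v) =
    \Sw[b, w <- tmap fst g t] (x ⇀ b) ⊗ w + \Sw[y, w <- tmap snd g t] σ x y ⊗ w)
  * (tmap snd g (\Sw[u, v <- t] m (inH x) u ⊗ v) =
    \Sw[b, w <- tmap fst g t] (x ◁ b) ⊗ w + \Sw[y, w <- tmap snd g t] (x ∗ y) ⊗ w).
Proof. by split; apply: tmap_dsuml => // ?; rewrite mul_pureE. Qed.

Lemma lmul_inA_right (f : {linear V -> X}) a :
  (tmap f fst (\Sw[u, v <- t] u ⊗ m (inA a) v) =
    \Sw[w, b <- tmap f fst t] w ⊗ (a ∙ b) + \Sw[w, y <- tmap f snd t] w ⊗ (a ↼ y))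
  * (tmap f snd (\Sw[u, v <- t] u ⊗ m (inA a) v) =
    \Sw[w, b <- tmap f fst t] w ⊗ θ a b + \Sw[w, y <- tmap f snd t] w ⊗ (a ▷ y)).
Proof. by split; apply: tmap_dsumr => // ?; rewrite mul_pureE. Qed.

Lemma lmul_inH_right (f : {linear V -> X}) x :
  (tmap f fst (\Sw[u, v <- t] u ⊗ m (inH x) v) =
    \Sw[w, b <- tmap f fst t] w ⊗ (x ⇀ b) + \Sw[w, y <- tmap f snd t] w ⊗ σ x y)
  * (tmap f snd (\Sw[u, v <- t] u ⊗ m (inH x) v) =
    \Sw[w, b <- tmap f fst t] w ⊗ (x ◁ b) + \Sw[w, y <- tmap f snd t] w ⊗ (x ∗ y)).
Proof. by split; apply: tmap_dsumr => // ?; rewrite mul_pureE. Qed.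

Lemma rmul_inA_right (f : {linear V -> X}) b :
  (tmap f fst (\Sw[u, v <- t] u ⊗ m v (inA b)) =
    \Sw[w, a <- tmap f fst t] w ⊗ (a ∙ b) + \Sw[w, x <- tmap f snd t] w ⊗ (x ⇀ b))
  * (tmap f snd (\Sw[u, v <- t] u ⊗ m v (inA b)) =
    \Sw[w, a <- tmap f fst t] w ⊗ θ a b + \Sw[w, x <- tmap f snd t] w ⊗ (x ◁ b)).
Proof. by split; apply: tmap_dsumr => // ?; rewrite mul_pureE. Qed.

Lemma rmul_inH_right (f : {linear V -> X}) y :
  (tmap f fst (\Sw[u, v <- t] u ⊗ m v (inH y)) =
    \Sw[w, a <- tmap f fst t] w ⊗ (a ↼ y) + \Sw[w, x <- tmap f snd t] w ⊗ σ x y)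
  * (tmap f snd (\Sw[u, v <- t] u ⊗ m v (inH y)) =
    \Sw[w, a <- tmap f fst t] w ⊗ (a ▷ y) + \Sw[w, x <- tmap f snd t] w ⊗ (x ∗ y)).
Proof. by split; apply: tmap_dsumr => // ?; rewrite mul_pureE. Qed.

End Act.

Definition act_componentE := (lmul_inA_left, lmul_inH_left, lmul_inA_right,
  lmul_inH_right, rmul_inA_right, rmul_inH_right).

Section Coact.
Variables (X : lmodType K) (t : V ⊗ V).

Lemma comul_left (h : {linear V -> X}) :
  (tmap (tmap fst fst) h (\Sw[u, v <- t] D u ⊗ v) =
    \Sw[a, w <- tmap fst h t] ΔA a ⊗ w + \Sw[x, w <- tmap snd h t] Q x ⊗ w)
  * (tmap (tmap snd fst) h (\Sw[u, v <- t] D u ⊗ v) =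
    \Sw[a, w <- tmap fst h t] φ a ⊗ w + \Sw[x, w <- tmap snd h t] γ x ⊗ w)
  * (tmap (tmap fst snd) h (\Sw[u, v <- t] D u ⊗ v) =
    \Sw[a, w <- tmap fst h t] ψ a ⊗ w + \Sw[x, w <- tmap snd h t] ρ x ⊗ w)
  * (tmap (tmap snd snd) h (\Sw[u, v <- t] D u ⊗ v) =
    \Sw[a, w <- tmap fst h t] P a ⊗ w + \Sw[x, w <- tmap snd h t] ΔH x ⊗ w).
Proof.
by split; [split; [split|]|]; apply: tmap_dsuml => [|?|?];
  rewrite /= ?comul_pureE //; apply: linearP.
Qed.

Lemma comul_right (f : {linear V -> X}) :
  (tmap (tmap f fst) fst (\Sw[u, v <- t] u ⊗: D v) =
    \Sw[w, a <- tmap f fst t] w ⊗: ΔA a + \Sw[w, x <- tmap f snd t] w ⊗: Q x)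
  * (tmap (tmap f snd) fst (\Sw[u, v <- t] u ⊗: D v) =
    \Sw[w, a <- tmap f fst t] w ⊗: φ a + \Sw[w, x <- tmap f snd t] w ⊗: γ x)
  * (tmap (tmap f fst) snd (\Sw[u, v <- t] u ⊗: D v) =
    \Sw[w, a <- tmap f fst t] w ⊗: ψ a + \Sw[w, x <- tmap f snd t] w ⊗: ρ x)
  * (tmap (tmap f snd) snd (\Sw[u, v <- t] u ⊗: D v) =
    \Sw[w, a <- tmap f fst t] w ⊗: P a + \Sw[w, x <- tmap f snd t] w ⊗: ΔH x).
Proof.
by split; [split; [split|]|]; apply: tmap_dsum_tensAr => ?; rewrite comul_pureE.
Qed.

End Coact.

(** * The symmetry conditions, component by component *)

Local Notation d := (derivator m D).
Local Notation coassoc := (coassociator D).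
Local Notation assoc := (associator m).

Definition comul_mapB := (linearB (cd_comulA E), linearB (cd_comulH E),
  linearB (cd_phi E), linearB (cd_psi E), linearB (cd_rho E),
  linearB (cd_gamma E), linearB (cd_P E), linearB (cd_Q E)).

Ltac derivator_component :=
  rewrite !tmap_derivator !mul_pureE !comul_pairE !act_componentE !comul_pureE.
Ltac coassociator_component :=
  rewrite !tmap_coassociator !comul_left !comul_right !comul_pureE.

Ltac expand_identity :=
  rewrite /tau12_fixed /= ?(tsum_commutatorl, tsum_commutatorr) /Defs.skew /commutator
    ?(comul_mapB, linearBl, tauB, tauD, tau12B, tau12D).

Ltac by_identity identity :=
  have := identity; expand_identity;
  let h := fresh in move=> h; abelian_from h.

Section DoubleMatchedPair.
Hypothesis pairE : cocycle_double_matched_pair E.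

(** For x in H and b in A all four components are given by the matched pair; the
    H ⊗ H component is stated there for [b, x], with the opposite sign. *)
Lemma derivator_sym :
    (forall a b, tmap fst fst (d (inA a) (inA b)) = tmap fst fst (d (inA b) (inA a))) ->
    (forall x y, tmap snd snd (d (inH x) (inH y)) = tmap snd snd (d (inH y) (inH x))) ->
  forall u v, d u v = d v u.
Proof.
move=> dAA dHH; apply: dsum_biadditive_sym => [u u' v|u v v'|a b|x y|x b].
- exact: derivatorDl.
- exact: derivatorDr.
- apply: tensor2_dsum_ext (dAA a b) _ _ _; derivator_component.
  + by_identity (cdm_bracket_AA_HA pairE a b).
  + by_identity (cdm_bracket_AA_AH pairE a b).
  + by_identity (cdm_bracket_AA_HH pairE a b).
- apply: tensor2_dsum_ext _ _ _ (dHH x y); derivator_component.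
  + by_identity (cdm_bracket_HH_AA pairE x y).
  + by_identity (cdm_bracket_HH_HA pairE x y).
  + by_identity (cdm_bracket_HH_AH pairE x y).
- apply: tensor2_dsum_ext; derivator_component.
  + by_identity (cdm_bracket_HA_AA pairE x b).
  + by_identity (cdm_bracket_HA_HA pairE x b).
  + by_identity (cdm_bracket_HA_AH pairE x b).
  + by_identity (esym (cdm_bracket_AH_HH pairE b x)).
Qed.

(** The mixed equation is the A ⊗ H or the H ⊗ A component of the condition, whichever
    the matched pair records; the flip turns one into the other. *)
Lemma derivator_tau :
    (forall a b, let t := tmap fst fst (d (inA a) (inA b)) in t = tau t) ->
    (forall x y, let t := tmap snd snd (d (inH x) (inH y)) in t = tau t) ->
  forall u v, tau (d u v) = d u v.
Proof.
move=> dAA dHH u v.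
have fixedD (t t' : V ⊗ V) : tau t = t -> tau t' = t' -> tau (t + t') = t + t'.
  by move=> et et'; rewrite tauD et et'.
rewrite [u]dsum_split [v]dsum_split !(derivatorDl, derivatorDr).
move: u.1 u.2 v.1 v.2 => a x b y; apply: (fixedD); apply: (fixedD).
- apply: tau_dsum_fixed (dAA a b) _ _; derivator_component.
  + by_identity (cdm_mul_AA_HH pairE a b).
  + by_identity (cdm_mul_AA_HA pairE a b).
- apply: tau_dsum_fixed; derivator_component.
  + by_identity (cdm_mul_AH_AA pairE a y).
  + by_identity (cdm_mul_AH_HH pairE a y).
  + apply: tau_eqC; by_identity (cdm_mul_AH_AH pairE a y).
- apply: tau_dsum_fixed; derivator_component.
  + by_identity (cdm_mul_HA_AA pairE x b).
  + by_identity (cdm_mul_HA_HH pairE x b).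
  + by_identity (cdm_mul_HA_HA pairE x b).
- apply: tau_dsum_fixed _ (dHH x y) _; derivator_component.
  + by_identity (cdm_mul_HH_AA pairE x y).
  + apply: tau_eqC; by_identity (cdm_mul_HH_AH pairE x y).
Qed.

End DoubleMatchedPair.

(** Twelve equations: three types of pairs (u, v), two types of w, two components. *)
Lemma associator_sym (crossE : cocycle_cross_product_system E) u v w :
  assoc u v w = assoc v u w.
Proof.
move: u v w; suff pure w : (forall a b, assoc (inA a) (inA b) w = assoc (inA b) (inA a) w)
    /\ (forall x y, assoc (inH x) (inH y) w = assoc (inH y) (inH x) w)
    /\ (forall x b, assoc (inH x) (inA b) w = assoc (inA b) (inH x) w).
  move=> u v w; apply: (@dsum_biadditive_sym _ _ _ V (fun u v => assoc u v w)).
  - by move=> *; apply: associatorD1.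
  - by move=> *; apply: associatorD2.
  - by case: (pure w).
  - by case: (pure w) => _ [].
  - by case: (pure w) => _ [].
rewrite [w]dsum_split; move: w.1 w.2 => c z.
split=> [a b | ]; last split=> [x y | x b]; rewrite !associatorD3; congr (_ + _);
  rewrite /associator !mul_pureE !(mul_pairA, mul_pairH, mul_Apair, mul_Hpair);
  congr pair; rewrite /=.
- by_identity (ccp_theta_left_symmetric crossE a b c).
- by_identity (ccp_theta_cocycle crossE a b c).
- by_identity (ccp_AAH_A crossE a b z).
- by_identity (ccp_AAH_H crossE a b z).
- by_identity (ccp_HHA_A crossE x y c).
- by_identity (ccp_HHA_H crossE x y c).
- by_identity (ccp_sigma_cocycle crossE x y z).
- by_identity (ccp_sigma_left_symmetric crossE x y z).
- by_identity (esym (ccp_HAA_A crossE x b c)).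
- by_identity (esym (ccp_HAA_H crossE b c x)).
- by_identity (ccp_AHH_A crossE b x z).
- by_identity (ccp_AHH_H crossE b x z).
Qed.

(** Six equations for each of A and H: the flip maps four of the eight components to
    themselves and exchanges the other four in pairs. *)
Lemma coassociator_fixed (cocrossE : cycle_cross_coproduct_system E) u :
  tau12 (coassoc u) = coassoc u.
Proof.
rewrite [u]dsum_split coassociatorD tau12D; congr (_ + _).
- move: u.1 => a; apply: tau12_dsum_fixed; coassociator_component.
  + by_identity (ccc_Q_left_symmetric cocrossE a).
  + by_identity (ccc_HHA_A cocrossE a).
  + by_identity (ccc_HAA_A cocrossE a).
  + by_identity (ccc_AAH_A cocrossE a).
  + by_identity (ccc_P_cycle cocrossE a).
  + apply: tau12_eqC; by_identity (esym (ccc_AHH_A cocrossE a)).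
- move: u.2 => x; apply: tau12_dsum_fixed; coassociator_component.
  + by_identity (ccc_Q_cycle cocrossE x).
  + by_identity (ccc_HHA_H cocrossE x).
  + by_identity (esym (ccc_HAA_H cocrossE x)).
  + by_identity (esym (ccc_AAH_H cocrossE x)).
  + by_identity (ccc_P_left_symmetric cocrossE x).
  + apply: tau12_eqC; by_identity (ccc_AHH_H cocrossE x).
Qed.

Lemma cross_bialgebraP (crossE : cocycle_cross_product_system E)
    (cocrossE : cycle_cross_coproduct_system E)
    (pairE : cocycle_double_matched_pair E) :
  left_symmetric_bialgebra m D <->
  cocycle_braided_bialgebra_A E /\ cocycle_braided_bialgebra_H E.
Proof.
rewrite left_symmetric_bialgebraE; split=> [[_ _ d_sym d_tau] | [braidedA braidedH]].
  split; split.
  - exact: ccp_theta_left_symmetric.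
  - exact: ccc_Q_left_symmetric.
  - move=> a b; have := congr1 (tmap fst fst) (d_sym (inA a) (inA b)).
    derivator_component; expand_identity => h; abelian_from h.
  - move=> a b; have := congr1 (tmap fst fst) (d_tau (inA a) (inA b)).
    rewrite tmap_tau; derivator_component; expand_identity => h; abelian_from (esym h).
  - exact: ccp_sigma_left_symmetric.
  - exact: ccc_P_left_symmetric.
  - move=> x y; have := congr1 (tmap snd snd) (d_sym (inH x) (inH y)).
    derivator_component; expand_identity => h; abelian_from h.
  - move=> x y; have := congr1 (tmap snd snd) (d_tau (inH x) (inH y)).
    rewrite tmap_tau; derivator_component; expand_identity => h; abelian_from (esym h).
split.
- exact: associator_sym.
- exact: coassociator_fixed.
- apply: derivator_sym => // [a b | x y]; derivator_component.
    by_identity (cbA_bracket braidedA a b).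
  by_identity (cbH_bracket braidedH x y).
- apply: derivator_tau => // [a b | x y] /=; derivator_component.
    by_identity (cbA_mul braidedA a b).
  by_identity (cbH_mul braidedH x y).
Qed.

End CrossBialgebra.

Theorem theorem4p14 (K : fieldType) (charK0 : [pchar K] =i pred0)
    (A H : lmodType K) (E : cross_data A H)
    (crossE : cocycle_cross_product_system E)
    (cocrossE : cycle_cross_coproduct_system E)
    (pairE : cocycle_double_matched_pair E) :
  left_symmetric_bialgebra (dsum_mul E) (dsum_comul E) <->
  cocycle_braided_bialgebra_A E /\ cocycle_braided_bialgebra_H E.
Proof. exact: cross_bialgebraP. Qed.
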